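(* Let $a\in\mathbb Z_+=\{0,1,2,\dots\}$, $b\in\mathbb R$, and let $\alpha$ be a multi-index with $|\alpha|\le\lfloor d/2\rfloor+1$. Assume that either (i) $a=b=0$ and $\alpha\neq0$, or (ii) $\gamma a+b-|\alpha|>-d$. Then there exists a constant $N=N(d,a,b,\gamma,\nu)$ such that $$\sup_{s<t,\ x\in\mathbb R^d}|q_{\alpha,a,b}(s,t,x)|\le N .$$
   Context: Standing assumptions: $d\in\mathbb N$, $\gamma\in(0,\infty)$, $\nu>0$, and $\psi:\mathbb R\times\mathbb R^d\to\mathbb C$ is measurable with $\Re[\psi(t,\xi)]\le-\nu|\xi|^\gamma$ for all $(t,\xi)$ and $|D_\xi^\alpha\psi(t,\xi)|\le\nu^{-1}|\xi|^{\gamma-|\alpha|}$ for all $t\in\mathbb R$, $\xi\neq0$, $|\alpha|\le\lfloor d/2\rfloor+1$. For $s<t$, a multi-index $\alpha$, and $\xi\ne0$, $$\hat q_{\alpha,a,b}(s,t,\xi)=D_\xi^\alpha\Big[\big((t-s)\psi(t,(t-s)^{-1/\gamma}\xi)\big)^a|\xi|^b\exp\Big(\int_s^t\psi(r,(t-s)^{-1/\gamma}\xi)\,dr\Big)\Big],$$ and $q_{\alpha,a,b}(s,t,x)=\mathcal F^{-1}[\hat q_{\alpha,a,b}(s,t,\cdot)](x)$, where $\mathcal F^{-1}[g](x)=(2\pi)^{-d}\int_{\mathbb R^d}e^{i\xi\cdot x}g(\xi)\,d\xi$. (A zeroth power is $1$.) *)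

(* Defs.v *)
From HB Require Import structures.
From mathcomp Require Import all_boot all_order all_algebra.
From mathcomp Require Import all_classical all_reals all_analysis.
From mathcomp Require Import complex.

Set Implicit Arguments.
Unset Strict Implicit.
Unset Printing Implicit Defensive.

Import Order.TTheory GRing.Theory Num.Theory.
Import numFieldNormedType.Exports.

Local Open Scope classical_set_scope.
Local Open Scope ring_scope.
Local Open Scope complex_scope.

Definition rV_display : measure_display.
Proof. exact: default_measure_display. Qed.

Section measurable_rV.
Variables (R : realType) (n : nat).

(* The Borel sigma-algebra of R^n, generated by the coordinate maps. *)
Let coord : 'I_n -> 'rV[R]_n -> R := fun i x => x ord0 i.

Let rV_set0 : g_sigma_preimage coord set0.
Proof. exact: sigma_algebra0. Qed.

Let rV_setC A : g_sigma_preimage coord A -> g_sigma_preimage coord (~` A).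
Proof. exact: sigma_algebraC. Qed.

Let rV_bigcup (F : _^nat) : (forall i, g_sigma_preimage coord (F i)) ->
  g_sigma_preimage coord (\bigcup_i (F i)).
Proof. exact: sigma_algebra_bigcup. Qed.

HB.instance Definition _ := @isMeasurable.Build rV_display 'rV[R]_n
  (g_sigma_preimage coord) rV_set0 rV_setC rV_bigcup.

End measurable_rV.

Lemma measurable_coord (R : realType) n (i : 'I_n) :
  measurable_fun [set: 'rV[R]_n] (fun x : 'rV[R]_n => x ord0 i).
Proof.
move=> _ Y mY; rewrite setTI; apply: sub_sigma_algebra => /=.
rewrite -bigcup_seq/=; exists i => /=; first by rewrite mem_index_enum.
by exists Y => //; rewrite setTI.
Qed.

Lemma measurable_fun_rVP (d : measure_display) (T : measurableType d)
    (R : realType) n (f : T -> 'rV[R]_n) :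
  measurable_fun [set: T] f <->
  forall i, measurable_fun [set: T] (fun x => f x ord0 i).
Proof.
split=> [mf i|mf].
  by apply: (measurableT_comp (measurable_coord i)).
move=> _ A mA; rewrite setTI.
pose G := [set B : set 'rV[R]_n | measurable (f @^-1` B)].
suff : G A by [].
apply: (smallest_sub _ _ mA) => /=.
  split => /=.
  - by rewrite /G /= preimage_set0; exact: measurable0.
  - by move=> B; rewrite /G /= setTD preimage_setC => mB; exact: measurableC.
  - move=> F mF; rewrite /G /= preimage_bigcup.
    by apply: bigcup_measurable => k _; exact: mF.
rewrite -bigcup_seq => B [i _ [C mC <-]]; rewrite /G /= setTI.
by have := mf i measurableT C mC; rewrite setTI.
Qed.

Section lebesgue_rV_step.
Variables (R : realType) (n : nat).
Variable mu : {sigma_finite_measure set 'rV[R]_n -> \bar R}.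
Local Open Scope ereal_scope.

Definition rV_cons (p : measurableTypeR R * 'rV[R]_n) : 'rV[R]_n.+1 :=
  row_mx (const_mx (p.1 : R) : 'rV[R]_1) p.2.

Lemma rV_cons0 p : rV_cons p ord0 ord0 = p.1.
Proof. by rewrite mxE; case: splitP => // j _; rewrite mxE. Qed.

Lemma rV_consS p i : rV_cons p ord0 (lift ord0 i) = p.2 ord0 i.
Proof.
rewrite mxE; case: splitP => [j|k] /=; first by rewrite ord1.
by rewrite /bump /= !add1n => -[ik]; congr (p.2 _ _); exact/val_inj.
Qed.

Lemma measurable_rV_cons : measurable_fun setT rV_cons.
Proof.
apply/measurable_fun_rVP => i; case: (unliftP ord0 i) => [j|] ->.
  under eq_fun do rewrite rV_consS.
  exact: (measurableT_comp (measurable_coord j) measurable_snd).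
under eq_fun do rewrite rV_cons0.
exact: measurable_fst.
Qed.

Definition lebesgue_rV_step : set 'rV[R]_n.+1 -> \bar R :=
  pushforward (lebesgue_measure \x mu) rV_cons.

Let step0 : lebesgue_rV_step set0 = 0.
Proof. by rewrite /lebesgue_rV_step /pushforward preimage_set0 measure0. Qed.

Let step_ge0 A : 0 <= lebesgue_rV_step A.
Proof. by rewrite /lebesgue_rV_step /pushforward measure_ge0. Qed.

Let mpre (A : set 'rV[R]_n.+1) : measurable A -> measurable (rV_cons @^-1` A).
Proof.
by move=> mA; rewrite -[X in measurable X]setTI; exact: measurable_rV_cons.
Qed.

Let step_sigma_additive : semi_sigma_additive lebesgue_rV_step.
Proof.
move=> F mF tF mUF; rewrite /lebesgue_rV_step /pushforward preimage_bigcup.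
apply: measure_semi_sigma_additive.
- by move=> k; exact: mpre.
- apply/trivIsetP => /= i j _ _ ij; rewrite -preimage_setI.
  by move/trivIsetP : tF => /(_ _ _ _ _ ij) ->//; rewrite preimage_set0.
- by rewrite -preimage_bigcup; exact: mpre.
Qed.

HB.instance Definition _ := isMeasure.Build _ _ _
  lebesgue_rV_step step0 step_ge0 step_sigma_additive.

Let step_sigma_finite : sigma_finite setT lebesgue_rV_step.
Proof.
have [F FT Foo] : sigma_finite setT (lebesgue_measure \x mu).
  have /sigma_finiteP[F [TF ndF Foo]] := sigma_finiteT (@lebesgue_measure R).
  have /sigma_finiteP[G [TG ndG Goo]] := sigma_finiteT mu.
  exists (fun k => F k `*` G k).
    rewrite -setXTT TF TG predeqE => -[x y]; split.
      move=> [/= [k _ Fkx] [l _ Gly]]; exists (maxn k l) => //; split.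
      - by move: x Fkx; exact/subsetPset/ndF/leq_maxl.
      - by move: y Gly; exact/subsetPset/ndG/leq_maxr.
    by move=> [k _ []/= ? ?]; split; exists k.
  move=> k; have [? ?] := Foo k; have [? ?] := Goo k.
  split; first exact: measurableX.
  by rewrite product_measure1E// lte_mul_pinfty// ge0_fin_numE.
pose h (x : 'rV[R]_n.+1) : measurableTypeR R * 'rV[R]_n :=
  (x ord0 ord0, \row_i x ord0 (lift ord0 i)).
have hK : cancel rV_cons h.
  move=> [a v]; rewrite /h rV_cons0; congr pair.
  by apply/rowP => i; rewrite mxE rV_consS.
have mh : measurable_fun setT h.
  apply/measurable_fun_pairP; split; first exact: measurable_coord.
  apply/measurable_fun_rVP => i /=.
  rewrite (_ : (fun x => _) = (fun x : 'rV[R]_n.+1 => x ord0 (lift ord0 i))).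
    exact: measurable_coord.
  by apply/funext => x; rewrite mxE.
exists (fun k => h @^-1` (F k)).
  by rewrite -preimage_bigcup -FT preimage_setT.
move=> k; have [mFk Fkoo] := Foo k; split.
  by rewrite -[X in measurable X]setTI; exact: mh.
rewrite /lebesgue_rV_step /pushforward -comp_preimage.
by rewrite (_ : h \o rV_cons = id) //; apply/funext => x; exact: hK.
Qed.

HB.instance Definition _ := Measure_isSigmaFinite.Build _ _ _
  lebesgue_rV_step step_sigma_finite.

End lebesgue_rV_step.

(* Lebesgue measure on R^n, by iterated products; see lebesgue_rV_box. *)
Fixpoint lebesgue_rV (R : realType) (n : nat) :
    {sigma_finite_measure set 'rV[R]_n -> \bar R} :=
  match n with
  | 0 => dirac (0 : 'rV[R]_0)
  | m.+1 => lebesgue_rV_step (lebesgue_rV R m)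
  end.

Lemma lebesgue_rV_box (R : realType) n (A : 'I_n -> set R) :
  (forall i, measurable (A i)) ->
  lebesgue_rV R n [set x : 'rV[R]_n | forall i, A i (x ord0 i)] =
  (\prod_(i < n) lebesgue_measure (A i : set (measurableTypeR R)))%E.
Proof.
elim: n A => [|n IH] A mA /=.
  rewrite big_ord0 diracE (_ : _ \in _ = true) //.
  by apply/mem_set => -[].
rewrite big_ord_recl -IH; last by move=> i; exact: mA.
rewrite /lebesgue_rV_step /pushforward.
set B := [set x : 'rV[R]_n | _].
rewrite (_ : _ @^-1` _ = (A ord0 : set (measurableTypeR R)) `*` B).
  apply: product_measure1E; first exact: mA.
  rewrite (_ : B = \bigcap_(i in [set: 'I_n])
      ((fun x : 'rV[R]_n => x ord0 i) @^-1` (A (lift ord0 i)))).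
    apply: fin_bigcap_measurable => // i _.
    by rewrite -[X in measurable X]setTI; exact: measurable_coord.
  by apply/seteqP; split => x /= h i; [move=> _; exact: h|exact: (h i)].
apply/seteqP; split => -[a v] /=.
  move=> h; split=> /= [|i]; first by have := h ord0; rewrite rV_cons0.
  by have := h (lift ord0 i); rewrite rV_consS.
move=> [/= h1 h2] i; case: (unliftP ord0 i) => [j|] ->.
  by rewrite rV_consS; exact: h2.
by rewrite rV_cons0.
Qed.

Section euclidean_space.
Variables (R : realType) (n : nat).
Implicit Types x y : 'rV[R]_n.

Definition dot x y : R := \sum_(i < n) x ord0 i * y ord0 i.

(* The norm `|x| of 'rV[R]_n in the library is the sup norm. *)
Definition enorm x : R := Num.sqrt (dot x x).

End euclidean_space.

Section complex_valued.
Variable R : realType.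

Definition cexp (z : R[i]) : R[i] :=
  (expR (complex.Re z))%:C * (cos (complex.Im z) +i* sin (complex.Im z)).

Definition cmeasurable (d : measure_display) (T : measurableType d)
    (f : T -> R[i]) : Prop :=
  measurable_fun [set: T] (fun x => complex.Re (f x)) /\
  measurable_fun [set: T] (fun x => complex.Im (f x)).

Definition cintegrable (d : measure_display) (T : measurableType d)
    (mu : {measure set T -> \bar R}) (D : set T) (f : T -> R[i]) : Prop :=
  mu.-integrable D (fun x => (complex.Re (f x))%:E) /\
  mu.-integrable D (fun x => (complex.Im (f x))%:E).

Definition cintegral (d : measure_display) (T : measurableType d)
    (mu : {measure set T -> \bar R}) (D : set T) (f : T -> R[i]) : R[i] :=
  (\int[mu]_(x in D) complex.Re (f x)) +i*
  (\int[mu]_(x in D) complex.Im (f x)).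

End complex_valued.

Section partial_derivatives.
Variables (R : realType) (n : nat).
Implicit Types (f : 'rV[R]_n -> R[i]) (i : 'I_n) (x : 'rV[R]_n).

Definition pderivable i f x : Prop :=
  derivable (fun y => complex.Re (f y)) x (delta_mx ord0 i) /\
  derivable (fun y => complex.Im (f y)) x (delta_mx ord0 i).

Definition pderiv i f x : R[i] :=
  'D_(delta_mx ord0 i) (fun y => complex.Re (f y)) x +i*
  'D_(delta_mx ord0 i) (fun y => complex.Im (f y)) x.

Definition pderivs (s : seq 'I_n) f : 'rV[R]_n -> R[i] := foldr pderiv f s.

Fixpoint pderivables_on (A : set 'rV[R]_n) (s : seq 'I_n) f : Prop :=
  if s is i :: s' then
    pderivables_on A s' f /\ forall x, A x -> pderivable i (pderivs s' f) x
  else True.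

Definition multi_index := {ffun 'I_n -> nat}.

Definition mi_abs (alpha : multi_index) : nat := (\sum_(i < n) alpha i)%N.

(* D^alpha = d_0^(alpha 0) ... d_(n-1)^(alpha (n-1)): the first index is the
   outermost derivative. *)
Definition mi_seq (alpha : multi_index) : seq 'I_n :=
  flatten [seq nseq (alpha i) i | i <- enum 'I_n].

Definition mderiv (alpha : multi_index) f : 'rV[R]_n -> R[i] :=
  pderivs (mi_seq alpha) f.

(* mderiv is total, with junk values where a limit does not exist; this says
   that every derivative taken in forming D^alpha f exists on A. *)
Definition mderivable_on (A : set 'rV[R]_n) (alpha : multi_index) f : Prop :=
  pderivables_on A (mi_seq alpha) f.

End partial_derivatives.

Definition nonzero (R : realType) (d : nat) : set 'rV[R]_d :=
  [set xi | xi != 0].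
Arguments nonzero : clear implicits.

Record symbol_assumption (R : realType) (d : nat) (gamma nu : R)
    (psi : R -> 'rV[R]_d -> R[i]) : Prop := SymbolAssumption {
  symbol_measurable : cmeasurable (fun p : R * 'rV[R]_d => psi p.1 p.2) ;
  symbol_elliptic : forall t xi,
    complex.Re (psi t xi) <= - (nu * enorm xi `^ gamma) ;
  symbol_derivable : forall t (alpha : multi_index d),
    (mi_abs alpha <= (d %/ 2).+1)%N ->
    mderivable_on (nonzero R d) alpha (psi t) ;
  symbol_bound : forall t (alpha : multi_index d) (xi : 'rV[R]_d),
    (mi_abs alpha <= (d %/ 2).+1)%N -> xi != 0 ->
    `|mderiv alpha (psi t) xi| <=
      (nu^-1 * enorm xi `^ (gamma - (mi_abs alpha)%:R))%:C }.

Section kernel.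
Variables (R : realType) (d : nat).

Definition q_base (gamma : R) (psi : R -> 'rV[R]_d -> R[i]) (a : nat) (b : R)
    (s t : R) (xi : 'rV[R]_d) : R[i] :=
  let eta := (t - s) `^ (- gamma^-1) *: xi in
  ((t - s)%:C * psi t eta) ^+ a * (enorm xi `^ b)%:C *
  cexp (cintegral lebesgue_measure `[s, t]
          (fun r : measurableTypeR R => psi r eta)).

Definition q_hat (gamma : R) (psi : R -> 'rV[R]_d -> R[i])
    (alpha : multi_index d) (a : nat) (b : R) (s t : R) : 'rV[R]_d -> R[i] :=
  mderiv alpha (q_base gamma psi a b s t).

Definition inv_fourier (g : 'rV[R]_d -> R[i]) (x : 'rV[R]_d) : R[i] :=
  ((2 * pi) ^- d)%:C *
  cintegral (lebesgue_rV R d) setT (fun xi => cexp (0 +i* dot xi x) * g xi).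

Definition q (gamma : R) (psi : R -> 'rV[R]_d -> R[i])
    (alpha : multi_index d) (a : nat) (b : R) (s t : R) : 'rV[R]_d -> R[i] :=
  inv_fourier (q_hat gamma psi alpha a b s t).

End kernel.

(* Main.v *)
(* Rescaling xi makes the bounds on the symbol independent of s and t: with
   c = (t-s)^(-1/gamma), the function (t-s) psi(t, c xi) and the exponent
   I(xi) = \int_s^t psi(r, c xi) dr (differentiated under the integral sign) obey
   |D^beta| <= C |xi|^(gamma-|beta|), while Re I <= -nu |xi|^gamma. Functions with
   such bounds are stable under products, and D_i e^I = (D_i I) e^I, so with
   n = |alpha|
     |q_hat(xi)| <= C |xi|^p (1 + |xi|^gamma/nu)^n exp(-nu |xi|^gamma),
   where p = gamma a + b - n in general, and p = gamma - n if a = b = 0 and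
   n > 0, because then at least one derivative falls on I. In both cases p > -d
   (in the second one since n <= d/2 + 1 and gamma > 0), so that the right-hand
   side is integrable: it is dominated by a geometric series of indicators of
   dyadic cubes. Its integral bounds the inverse Fourier transform. *)

Require Import Defs.
From mathcomp Require Import all_boot all_order all_algebra.
From mathcomp Require Import all_classical all_reals all_analysis.
From mathcomp Require Import measurable_realfun complex ring lra.

Set Implicit Arguments.
Unset Strict Implicit.
Unset Printing Implicit Defensive.

Import Order.TTheory GRing.Theory Num.Theory.
Import numFieldNormedType.Exports.

Local Open Scope classical_set_scope.
Local Open Scope ring_scope.
Local Open Scope complex_scope.

Notation cnorm := (@Normc.normc _).

(** * Real-valued modulus of complex numbers *)

Section cnorm.
Context {R : realType}.
Implicit Types z w : R[i].

Lemma cnormE z : cnorm z = Num.sqrt (complex.Re z ^+ 2 + complex.Im z ^+ 2).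
Proof. by case: z. Qed.

Lemma normC_le z (r : R) : (`|z| <= r%:C) = (cnorm z <= r).
Proof. by rewrite -lecR. Qed.

Lemma cnorm_ge0 z : 0 <= cnorm z.
Proof. by rewrite cnormE sqrtr_ge0. Qed.

Lemma cnormM z w : cnorm (z * w) = cnorm z * cnorm w.
Proof. exact: Normc.normcM. Qed.

Lemma cnormD z w : cnorm (z + w) <= cnorm z + cnorm w.
Proof. exact: le_normcD. Qed.

Lemma cnormR (r : R) : cnorm r%:C = `|r|.
Proof. by rewrite cnormE /= expr0n /= addr0 sqrtr_sqr. Qed.

Lemma Re_le_cnorm z : `|complex.Re z| <= cnorm z.
Proof. by rewrite cnormE -sqrtr_sqr ler_wsqrtr // lerDl sqr_ge0. Qed.

Lemma Im_le_cnorm z : `|complex.Im z| <= cnorm z.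
Proof. by rewrite cnormE -sqrtr_sqr ler_wsqrtr // lerDr sqr_ge0. Qed.

Lemma cnorm_le_ReIm z : cnorm z <= `|complex.Re z| + `|complex.Im z|.
Proof.
rewrite {1}[z]complexE; apply: (le_trans (cnormD _ _)).
rewrite cnormM !cnormR lerD2l.
by rewrite cnormE /= expr0n expr1n add0r sqrtr1 mul1r.
Qed.

Lemma cnorm_cexp z : cnorm (cexp z) = expR (complex.Re z).
Proof.
rewrite /cexp cnormM cnormR ger0_norm ?expR_ge0 // cnormE /=.
by rewrite cos2Dsin2 sqrtr1 mulr1.
Qed.

End cnorm.

(** * The Euclidean norm and its real powers *)

Section euclidean_norm.
Context {R : realType} {n : nat}.
Implicit Types x : 'rV[R]_n.

Lemma dot_ge0 x : 0 <= dot x x.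
Proof. by apply: sumr_ge0 => i _; rewrite -expr2 sqr_ge0. Qed.

Lemma dot_gt0 x : x != 0 -> 0 < dot x x.
Proof.
move=> x0; rewrite lt_neqAle dot_ge0 andbT eq_sym; apply: contraNN x0.
rewrite psumr_eq0 => [/allP h|i _]; last by rewrite -expr2 sqr_ge0.
apply/eqP/rowP => i; rewrite mxE.
have := h i; rewrite mem_index_enum => /(_ isT) /=.
by rewrite mulf_eq0 orbb => /eqP.
Qed.

Lemma enorm_ge0 x : 0 <= enorm x.
Proof. exact: sqrtr_ge0. Qed.

Lemma enorm_gt0 x : x != 0 -> 0 < enorm x.
Proof. by move=> x0; rewrite sqrtr_gt0 dot_gt0. Qed.

Lemma enormZ (c : R) x : 0 <= c -> enorm (c *: x) = c * enorm x.
Proof.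
move=> c0; rewrite /enorm (_ : dot _ _ = c ^+ 2 * dot x x).
  by rewrite sqrtrM ?sqr_ge0 // sqrtr_sqr ger0_norm.
by rewrite /dot mulr_sumr; apply: eq_bigr => i _; rewrite !mxE; ring.
Qed.

Lemma coord_le_enorm x i : `|x ord0 i| <= enorm x.
Proof.
rewrite -sqrtr_sqr ler_wsqrtr // /dot (bigD1 i) //= -expr2 lerDl.
by apply: sumr_ge0 => j _; rewrite -expr2 sqr_ge0.
Qed.

Lemma enorm_powR x (b : R) : enorm x `^ b = dot x x `^ (b / 2).
Proof. by rewrite /enorm -powR12_sqrt ?dot_ge0 // -powRrM mulrC. Qed.

Lemma enorm_powRD x (a b : R) : x != 0 ->
  enorm x `^ (a + b) = enorm x `^ a * enorm x `^ b.
Proof. by move=> x0; rewrite powRD //; apply/implyP => _; rewrite gt_eqF ?enorm_gt0. Qed.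

Lemma enorm_powRB1 x (a : R) : x != 0 ->
  enorm x `^ (a - 1) = enorm x `^ a / enorm x.
Proof. by move=> x0; rewrite enorm_powRD // powR_inv1 // enorm_ge0. Qed.

Lemma near_nonzero x : x != 0 -> \near x, x != 0.
Proof.
move=> x0; have : nbhs x (~` [set 0]).
  apply: open_nbhs_nbhs; split; last exact/eqP.
  rewrite openC; apply: accessible_closed_set1; apply: hausdorff_accessible.
  exact: norm_hausdorff.
by apply: filterS => y /eqP.
Qed.

End euclidean_norm.

(** * Directional and partial derivatives, with the rules of calculus for them *)

Section directional_derivative.
Context {R : realType} {V : normedModType R}.
Implicit Types (f : V -> R) (x v : V).

(** Both sides have the same difference quotient. Through this equivalence the one-variable chain
    rule and the one-variable differentiation under the integral sign become available for partial
    derivatives. *)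
Lemma is_derive_lineP f x v df :
  is_derive x v f df <-> is_derive (0 : R) 1 (fun h => f (h *: v + x)) df.
Proof.
have E : 'D_v f x = 'D_1 (fun h : R => f (h *: v + x)) 0.
  rewrite /derive; set g1 := fun h => h^-1 *: _; set g2 := fun h => h^-1 *: _.
  suff -> : g1 = g2 by [].
  by apply/funext => h; rewrite /g1 /g2 /= addr0 scale0r add0r [_%:A]mulr1.
split=> -[d e].
  by apply: DeriveDef; [exact: (derivable1P _ _ _).1|rewrite -E].
by apply: DeriveDef; [exact: (derivable1P _ _ _).2|rewrite E].
Qed.

End directional_derivative.

Section directional_derivative_comp.
Context {R : realType} {V : normedModType R}.
Implicit Types (f : V -> R) (x v : V).

Lemma is_derive_line f x v (u df : R) :
  is_derive (u *: v + x) v f df ->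
  is_derive u 1 (fun h => f (h *: v + x)) df.
Proof.
move=> /is_derive_lineP h; apply/is_derive_lineP; move: h.
set g := (X in is_derive _ _ X _) => h.
set k := (X in is_derive _ _ X _); rewrite (_ : k = g) //.
by apply/funext => r; rewrite /k /g scalerDl addrA [_%:A]mulr1.
Qed.

Lemma is_derive_comp1 (g : R -> R) f x v (dg df : R) :
  is_derive (f x) 1 g dg -> is_derive x v f df ->
  is_derive x v (g \o f) (dg * df).
Proof.
move=> hg /is_derive_lineP hf; apply/is_derive_lineP.
have := @is_derive1_comp R g (fun h => f (h *: v + x)) 0 dg df.
by rewrite scale0r add0r; exact.
Qed.

End directional_derivative_comp.

Section partial_derivatives_rules.
Context {R : realType} {n : nat}.
Implicit Types (f g : 'rV[R]_n -> R[i]) (i : 'I_n) (x : 'rV[R]_n).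
Let Re := @complex.Re R.
Let Im := @complex.Im R.

(** Existence and value are carried together, so that the rules below compose without separate side
    conditions on derivability. *)
Definition is_pderiv i f x (df : R[i]) : Prop :=
  is_derive x (delta_mx ord0 i) (fun y => Re (f y)) (Re df) /\
  is_derive x (delta_mx ord0 i) (fun y => Im (f y)) (Im df).

Lemma pderivP i f x : pderivable i f x -> is_pderiv i f x (pderiv i f x).
Proof. by case=> h1 h2; split; exact: derivableP. Qed.

Lemma is_pderivE i f x df : is_pderiv i f x df -> pderiv i f x = df.
Proof. by case: df => a b [/= [_ h1] [_ h2]]; rewrite /pderiv h1 h2. Qed.

Lemma is_pderivW i f x df : is_pderiv i f x df -> pderivable i f x.
Proof. by case=> -[h1 _] [h2 _]. Qed.

Lemma is_pderiv_near i f g x df : (\near x, f x = g x) ->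
  is_pderiv i f x df -> is_pderiv i g x df.
Proof.
move=> fg [h1 h2]; split; [apply: near_eq_is_derive h1|
  apply: near_eq_is_derive h2]; by apply: filterS fg => y ->.
Qed.

Lemma is_pderiv_cst i (c : R[i]) x : is_pderiv i (cst c) x 0.
Proof. by split; exact: is_derive_cst. Qed.

Lemma is_pderivD i f g x df dg : is_pderiv i f x df -> is_pderiv i g x dg ->
  is_pderiv i (fun y => f y + g y) x (df + dg).
Proof.
move=> [f1 f2] [g1 g2].
have E1 (z w : R[i]) : Re (z + w) = Re z + Re w by case: z; case: w.
have E2 (z w : R[i]) : Im (z + w) = Im z + Im w by case: z; case: w.
split; [rewrite E1|rewrite E2].
  under eq_fun do rewrite E1.
  exact: (is_deriveD f1 g1).
under eq_fun do rewrite E2.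
exact: is_deriveD.
Qed.

Lemma is_pderivM i f g x df dg : is_pderiv i f x df -> is_pderiv i g x dg ->
  is_pderiv i (fun y => f y * g y) x (df * g x + f x * dg).
Proof.
move=> [f1 f2] [g1 g2].
have E1 (z w : R[i]) : Re (z * w) = Re z * Re w - Im z * Im w.
  by case: z; case: w.
have E2 (z w : R[i]) : Im (z * w) = Re z * Im w + Im z * Re w.
  by case: z; case: w.
split.
  under eq_fun do rewrite E1.
  apply: is_derive_eq (is_deriveB (is_deriveM f1 g1) (is_deriveM f2 g2)) _.
  rewrite /GRing.scale /=.
  by case: (f x) (g x) df dg {f1 f2 g1 g2} => ? ? [? ?] [? ?] [? ?] /=; ring.
under eq_fun do rewrite E2.
apply: is_derive_eq (is_deriveD (is_deriveM f1 g2) (is_deriveM f2 g1)) _.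
rewrite /GRing.scale /=.
by case: (f x) (g x) df dg {f1 f2 g1 g2} => ? ? [? ?] [? ?] [? ?] /=; ring.
Qed.

Lemma is_pderiv_real i (f : 'rV[R]_n -> R) x (df : R) :
  is_derive x (delta_mx ord0 i) f df ->
  is_pderiv i (fun y => (f y)%:C) x df%:C.
Proof. by move=> h; split => //=; exact: is_derive_cst. Qed.

Lemma is_pderiv_cexp i f x df : is_pderiv i f x df ->
  is_pderiv i (fun y => cexp (f y)) x (df * cexp (f x)).
Proof.
move=> [f1 f2].
have E1 (z : R[i]) : Re (cexp z) = expR (Re z) * cos (Im z).
  by case: z => a b; rewrite /cexp /= mul0r subr0.
have E2 (z : R[i]) : Im (cexp z) = expR (Re z) * sin (Im z).
  by case: z => a b; rewrite /cexp /= mul0r addr0.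
have ef := is_derive_comp1 (is_derive_expR (Re (f x))) f1.
have cf := is_derive_comp1 (is_derive_cos (Im (f x))) f2.
have sf := is_derive_comp1 (is_derive_sin (Im (f x))) f2.
split.
  under eq_fun do rewrite E1.
  apply: is_derive_eq (is_deriveM ef cf) _.
  rewrite /GRing.scale /= /cexp -/(Re _) -/(Im _).
  by case: df {f1 f2 ef cf sf} => p q /=; ring.
under eq_fun do rewrite E2.
apply: is_derive_eq (is_deriveM ef sf) _.
rewrite /GRing.scale /= /cexp -/(Re _) -/(Im _).
by case: df {f1 f2 ef cf sf} => p q /=; ring.
Qed.

Lemma is_pderiv_scale i f x (c : R) df : is_pderiv i f (c *: x) df ->
  is_pderiv i (fun y => f (c *: y)) x (c%:C * df).
Proof.
have key (h : 'rV[R]_n -> R) dh : is_derive (c *: x) (delta_mx ord0 i) h dh ->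
    is_derive x (delta_mx ord0 i) (fun y => h (c *: y)) (c * dh).
  move=> /is_derive_lineP hh; apply/is_derive_lineP.
  have hc : is_derive (0 : R) (1 : R) (fun r : R => c * r) c.
    apply: is_derive_eq (is_deriveM (is_derive_cst (c : R) (0 : R) (1 : R))
      (is_derive_id (0 : R) (1 : R))) _.
    by rewrite /cst /= scaler0 addr0 [_ *: _]mulr1.
  have := @is_derive1_comp R _ _ 0 dh c _ hc; rewrite mulr0 => /(_ _ hh).
  rewrite mulrC; set u := (X in is_derive _ _ X _ -> _).
  set w := (X in _ -> is_derive _ _ X _); rewrite (_ : u = w) //.
  by apply/funext => r; rewrite /u /w /= scalerDr scalerA.
case: df => a b [h1 h2]; split => /=; rewrite mul0r ?subr0 ?addr0; exact: key.
Qed.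

Lemma is_derive_coord i j x :
  is_derive x (delta_mx ord0 i) (fun y : 'rV[R]_n => y ord0 j) (i == j)%:R.
Proof.
apply/is_derive_lineP.
rewrite (_ : (fun h => _) = (fun h : R => h * (i == j)%:R + x ord0 j)).
  apply: is_derive_eq (is_deriveD (is_deriveM (is_derive_id (0 : R) (1 : R))
    (is_derive_cst ((i == j)%:R : R) (0 : R) (1 : R)))
    (is_derive_cst (x ord0 j : R) (0 : R) (1 : R))) _.
  by rewrite /cst /= scaler0 add0r addr0 [_ *: _]mulr1.
by apply/funext => h; rewrite !mxE /= eq_sym.
Qed.

Lemma is_derive_dot i x :
  is_derive x (delta_mx ord0 i) (fun y : 'rV[R]_n => dot y y) (2 * x ord0 i).
Proof.
rewrite (_ : (fun y => _) =
  \sum_(j < n) ((fun y : 'rV[R]_n => y ord0 j) * (fun y => y ord0 j)));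
  last by apply/funext => y; rewrite /dot fct_sumE.
apply: is_derive_eq.
  by apply: is_derive_sum => j; apply: is_deriveM; exact: is_derive_coord.
rewrite (bigD1 i) //= big1 => [|j /negbTE ji].
  by rewrite eqxx addr0 /GRing.scale /=; ring.
by rewrite eq_sym ji scaler0 addr0.
Qed.

(** Chain rule for [|y|^b = (y.y)^(b/2)], where the base [y.y] is a polynomial and is positive near
    [x]. *)
Lemma is_derive_enorm_powR i x (b : R) : x != 0 ->
  is_derive x (delta_mx ord0 i) (fun y => enorm y `^ b)
    (b * (x ord0 i * enorm x `^ (b - 2))).
Proof.
move=> x0; rewrite (_ : (fun y => _) = (fun r : R => r `^ (b / 2)) \o
  (fun y : 'rV[R]_n => dot y y)); last by apply/funext => y; exact: enorm_powR.
have h1 := is_derive1_powR (b / 2) (dot_gt0 x0).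
apply: is_derive_eq (@is_derive_comp1 _ _ _ (fun y : 'rV[R]_n => dot y y)
  _ _ _ _ h1 (is_derive_dot i x)) _.
by rewrite enorm_powR (_ : (b - 2) / 2 = b / 2 - 1); [field|field].
Qed.

End partial_derivatives_rules.

(** * Calculus of symbol classes: functions losing one power of [|x|] per derivative *)

Section symbol_class.
Context {R : realType} {n : nat}.
Implicit Types (f g : 'rV[R]_n -> R[i]) (w : 'rV[R]_n -> R) (l : seq 'I_n).

(* [f] and its derivatives along subsequences of [l] exist off the origin and
   lose one power of |x| per derivative. The head of [l] is differentiated
   first, so that [pderivs s] corresponds to [l = rev s]. *)
Fixpoint symb l w f : Prop :=
  if l is i :: l' then
    [/\ symb l' w f, (forall x, x != 0 -> pderivable i f x) &
        symb l' (fun x => w x / enorm x) (pderiv i f)]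
  else forall x, x != 0 -> cnorm (f x) <= w x.

Lemma symb_bound l w f : symb l w f -> forall x, x != 0 -> cnorm (f x) <= w x.
Proof. by elim: l => //= i l IH [/IH]. Qed.

Lemma symb_ge0 l w f : symb l w f -> forall x, x != 0 -> 0 <= w x.
Proof. by move=> /symb_bound h x /h; apply: le_trans; exact: cnorm_ge0. Qed.

(** The complement of the origin is open, so the two functions agree near each of its points and
    have the same derivatives there. *)
Lemma symb_eq l w f g : (forall x, x != 0 -> f x = g x) ->
  symb l w f -> symb l w g.
Proof.
elim: l w f g => /= [w f g fg h x x0|i l IH w f g fg [h1 h2 h3]].
  by rewrite -fg // h.
have nfg (x : 'rV[R]_n) : x != 0 -> \near x, f x = g x.
  by move=> /near_nonzero; apply: filterS => y; exact: fg.
split; first exact: IH h1.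
  by move=> x x0; apply: is_pderivW (is_pderiv_near (nfg x x0) (pderivP (h2 x x0))).
apply: IH h3 => x x0.
by apply/esym/is_pderivE/(is_pderiv_near (nfg x x0))/pderivP/h2.
Qed.

Lemma symb_le l w w' f : (forall x, x != 0 -> w x <= w' x) ->
  symb l w f -> symb l w' f.
Proof.
elim: l w w' f => /= [w w' f ww h x x0|i l IH w w' f ww [h1 h2 h3]].
  by apply: le_trans (h x x0) _; exact: ww.
split => //; first exact: IH h1.
by apply: IH h3 => x x0; rewrite ler_wpM2r ?ww // invr_ge0 enorm_ge0.
Qed.

Lemma symbD l w w' f g : symb l w f -> symb l w' g ->
  symb l (fun x => w x + w' x) (fun x => f x + g x).
Proof.
elim: l w w' f g => /= [w w' f g hf hg x x0|
    i l IH w w' f g [f1 f2 f3] [g1 g2 g3]].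
  by apply: (le_trans (cnormD _ _)); rewrite lerD ?hf ?hg.
have D (x : 'rV[R]_n) : x != 0 -> is_pderiv i (fun y => f y + g y) x
    (pderiv i f x + pderiv i g x).
  by move=> x0; apply: is_pderivD; apply: pderivP; auto.
split; first exact: IH.
  by move=> x /D /is_pderivW.
apply: symb_eq (symb_le _ (IH _ _ _ _ f3 g3)) => x x0.
  by rewrite (is_pderivE (D x x0)).
by rewrite mulrDl.
Qed.

(** By the product rule each derivative yields two products, both with weight [w w' / |x|]; this
    doubles the constant once per entry of [l]. *)
Lemma symbM l w w' f g : symb l w f -> symb l w' g ->
  symb l (fun x => 2 ^+ size l * (w x * w' x)) (fun x => f x * g x).
Proof.
elim: l w w' f g => /= [w w' f g hf hg x x0|
    i l IH w w' f g [f1 f2 f3] [g1 g2 g3]].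
  by rewrite expr0 mul1r cnormM ler_pM ?cnorm_ge0 ?hf ?hg.
have D (x : 'rV[R]_n) : x != 0 -> is_pderiv i (fun y => f y * g y) x
    (pderiv i f x * g x + f x * pderiv i g x).
  by move=> x0; apply: is_pderivM; apply: pderivP; auto.
split.
- apply: symb_le (IH _ _ _ _ f1 g1) => x x0.
  apply: ler_wpM2r; first by rewrite mulr_ge0 ?(symb_ge0 f1) ?(symb_ge0 g1).
  by rewrite exprS ler_peMl ?exprn_ge0 // ler1n.
- by move=> x /D /is_pderivW.
- apply: symb_eq (symb_le _ (symbD (IH _ _ _ _ f3 g1) (IH _ _ _ _ f1 g3))).
    by move=> x x0; rewrite (is_pderivE (D x x0)).
  move=> x x0; rewrite exprS le_eqVlt; apply/orP; left; apply/eqP.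
  ring.
Qed.

Lemma symb0 l w : (forall x, x != 0 -> 0 <= w x) -> symb l w (cst 0).
Proof.
elim: l w => [w w0 x x0|i l IH w w0].
  by rewrite (_ : cnorm _ = 0) ?w0 //; exact: Normc.normc0.
have D (x : 'rV[R]_n) : is_pderiv i (cst (0 : R[i])) x 0 := is_pderiv_cst i 0 x.
split; [exact: IH|by move=> x _; exact: is_pderivW (D x)|].
apply: symb_eq (IH _ _) => x x0; first by rewrite (is_pderivE (D x)).
by rewrite divr_ge0 ?w0 ?enorm_ge0.
Qed.

Lemma symb_cst l (c : R[i]) : symb l (fun=> cnorm c) (cst c).
Proof.
elim: l => [//|i l IH] /=.
have D (x : 'rV[R]_n) : is_pderiv i (cst c) x 0 := is_pderiv_cst i c x.
split; [exact: IH|by move=> x _; exact: is_pderivW (D x)|].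
apply: symb_eq (@symb0 l _ _) => x x0; first by rewrite (is_pderivE (D x)).
by rewrite divr_ge0 ?cnorm_ge0 ?enorm_ge0.
Qed.

Lemma symbZ l w (c : R[i]) f : symb l w f ->
  symb l (fun x => cnorm c * w x) (fun x => c * f x).
Proof.
elim: l w f => /= [w f hf x x0|i l IH w f [f1 f2 f3]].
  by rewrite cnormM ler_wpM2l ?cnorm_ge0 ?hf.
have D (x : 'rV[R]_n) : x != 0 -> is_pderiv i (fun y => c * f y) x (c * pderiv i f x).
  move=> x0; have := is_pderivM (is_pderiv_cst i c x) (pderivP (f2 x x0)).
  by rewrite mul0r add0r.
split; [exact: IH|by move=> x /D /is_pderivW|].
apply: symb_eq (symb_le _ (IH _ _ f3)) => x x0.
  by rewrite (is_pderivE (D x x0)).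
by rewrite mulrA.
Qed.

Lemma symbX l w f (k : nat) : symb l w f ->
  symb l (fun x => 2 ^+ (size l * k) * w x ^+ k) (fun x => f x ^+ k).
Proof.
move=> hf; elim: k => [|k IH].
  apply: symb_eq (symb_le _ (symb_cst l 1)) => x x0.
    by rewrite expr0.
  by rewrite muln0 !expr0 mulr1 (_ : cnorm _ = 1) //; exact: Normc.normc1.
apply: symb_eq (symb_le _ (symbM hf IH)) => x x0; first by rewrite exprS.
by rewrite mulnS exprD exprS le_eqVlt; apply/orP; left; apply/eqP; ring.
Qed.

Lemma symb_coord l j :
  symb l (@enorm R n) (fun x => (x ord0 j)%:C).
Proof.
elim: l => [x x0|i l IH]; first by rewrite cnormR coord_le_enorm.
have D (x : 'rV[R]_n) : is_pderiv i (fun x : 'rV[R]_n => (x ord0 j)%:C) x ((i == j)%:R)%:C.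
  exact/is_pderiv_real/is_derive_coord.
split => //; first by move=> x _; exact: is_pderivW (D x).
apply: symb_eq (symb_le _ (symb_cst l ((i == j)%:R)%:C)) => x x0.
  by rewrite (is_pderivE (D x)).
rewrite divff ?(gt_eqF (enorm_gt0 x0)) // cnormR.
by case: eqP; rewrite ?normr1 ?normr0.
Qed.

(** Induction on the number of derivatives with [b] varying: the derivative [b x_i |x|^(b-2)] is a
    product of a coordinate, of order 1, and a power covered by the induction hypothesis. The
    constant is chosen before [l], hence is the same for all sequences of length [k]. *)
Lemma symb_enorm_powR (k : nat) (b : R) : exists2 C : R, 0 <= C &
  forall l, size l = k ->
    symb l (fun x => C * enorm x `^ b) (fun x => (enorm x `^ b)%:C).
Proof.
elim: k b => [b|k IH b].
  exists 1 => // -[|//] _ x x0.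
  by rewrite mul1r cnormR ger0_norm ?powR_ge0.
have [C1 C10 h1] := IH b; have [C2 C20 h2] := IH (b - 2).
(* [C1] serves when the head derivative is skipped, the second term when it is taken; [2 ^+ k] is
   the product-rule constant of [symbM]. *)
exists (C1 + `|b| * (2 ^+ k * C2)) => [|[//|i l] [lk] /=].
  by rewrite addr_ge0 ?mulr_ge0 ?exprn_ge0.
have D (x : 'rV[R]_n) : x != 0 -> is_pderiv i (fun x => (enorm x `^ b)%:C) x
    (b * (x ord0 i * enorm x `^ (b - 2)))%:C.
  by move=> x0; apply/is_pderiv_real/is_derive_enorm_powR.
split.
- apply: symb_le (h1 _ lk) => x x0; rewrite ler_wpM2r ?powR_ge0 // lerDl.
  by rewrite ?mulr_ge0 ?exprn_ge0.
- by move=> x /D /is_pderivW.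
- apply: symb_eq (symb_le _ (symbZ b%:C (symbM (symb_coord l i) (h2 _ lk)))).
    by move=> x x0; rewrite (is_pderivE (D x x0)) -!rmorphM.
  move=> x x0; rewrite cnormR lk.
  have -> : b - 2 = b - 1 - 1 by ring.
  rewrite !enorm_powRB1 //.
  have e0 : enorm x != 0 by rewrite gt_eqF ?enorm_gt0.
  have -> : `|b| * (2 ^+ k * (enorm x * (C2 * (enorm x `^ b / enorm x / enorm x))))
    = `|b| * (2 ^+ k * C2) * (enorm x `^ b / enorm x) by field.
  rewrite mulrDl mulrDl -!mulrA lerDr.
  by rewrite ?mulr_ge0 ?powR_ge0 ?invr_ge0 ?enorm_ge0.
Qed.

(** Each derivative brings out a factor [c], which is cancelled by [|c x| = c |x|] in the
    denominator of the weight. *)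
Lemma symb_scale l w f (c : R) : 0 < c -> symb l w f ->
  symb l (fun x => w (c *: x)) (fun x => f (c *: x)).
Proof.
move=> c0; have cn0 (x : 'rV[R]_n) : x != 0 -> c *: x != 0.
  by move=> x0; rewrite scaler_eq0 negb_or x0 gt_eqF.
elim: l w f => /= [w f hf x x0|i l IH w f [f1 f2 f3]]; first exact/hf/cn0.
have D (x : 'rV[R]_n) : x != 0 -> is_pderiv i (fun y => f (c *: y)) x
    (c%:C * pderiv i f (c *: x)).
  by move=> x0; apply/is_pderiv_scale/pderivP/f2/cn0.
split; [exact: IH|by move=> x /D /is_pderivW|].
apply: symb_eq (symb_le _ (symbZ c%:C (IH _ _ f3))) => x x0.
  by rewrite (is_pderivE (D x x0)).
rewrite cnormR (gtr0_norm c0) (enormZ _ (ltW c0)).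
have e0 : enorm x != 0 by rewrite gt_eqF ?enorm_gt0.
by rewrite le_eqVlt; apply/orP; left; apply/eqP; field; rewrite e0 gt_eqF.
Qed.

(** This is [2^(0 + 1 + ... + (k-1))], the accumulated product-rule constants of [k] successive
    derivatives of an exponential. *)
Fixpoint cexp_cst (k : nat) : R :=
  if k is k'.+1 then 2 ^+ k' * cexp_cst k' else 1.

Lemma cexp_cst_ge0 k : 0 <= cexp_cst k.
Proof. by elim: k => //= k IH; rewrite mulr_ge0 ?exprn_ge0. Qed.

Let cexp_weight l w f :=
  fun x => cexp_cst (size l) * (1 + w x) ^+ size l * cnorm (cexp (f x)).

(** The first derivative of the exponential keeps a genuine factor [w x / enorm x], not yet weakened
    to [(1 + w x) / enorm x]. The case [a = b = 0] rests on this gain. *)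
Lemma symb_cexp_pderiv l w i f :
  (forall x, x != 0 -> pderivable i f x) ->
  symb l (fun x => w x / enorm x) (pderiv i f) ->
  symb l (cexp_weight l w f) (fun x => cexp (f x)) ->
  symb l (fun x => 2 ^+ size l * (w x / enorm x * cexp_weight l w f x))
    (pderiv i (fun x => cexp (f x))).
Proof.
move=> df h1 h2; apply: symb_eq (symbM h1 h2) => x x0.
by apply/esym/is_pderivE/is_pderiv_cexp/pderivP/df.
Qed.

(** Since [D_i e^f = (D_i f) e^f], every derivative costs at most one factor [1 + w]. The modulus of
    [e^f] stays in the weight, so that its decay can be used later. *)
Lemma symb_cexp l w f : symb l w f ->
  symb l (cexp_weight l w f) (fun x => cexp (f x)).
Proof.
rewrite /cexp_weight.
elim: l w f => /= [w f hf x x0|i l IH w f [f1 f2 f3]].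
  by rewrite expr0 !mul1r.
have w0 := symb_ge0 f1.
split.
- apply: symb_le (IH _ _ f1) => x x0.
  rewrite ler_wpM2r ?cnorm_ge0 // ler_pM ?exprn_ge0 ?addr_ge0 ?cexp_cst_ge0 ?w0 //.
    by rewrite ler_peMl ?cexp_cst_ge0 // exprn_ege1 // ler1n.
  by rewrite exprS ler_peMl ?exprn_ge0 ?addr_ge0 ?w0 // lerDl w0.
- by move=> x x0; exact/(is_pderivW (is_pderiv_cexp (pderivP (f2 x x0)))).
- apply: symb_le (symb_cexp_pderiv f2 f3 (IH _ _ f1)) => x x0.
  rewrite /cexp_weight exprS.
  set A := cexp_cst _; set B := (_ + _) ^+ _; set E := cnorm _.
  rewrite (_ : _ * _ = 2 ^+ size l * A * (w x * B) * E / enorm x); last by ring.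
  rewrite ler_wpM2r ?invr_ge0 ?enorm_ge0 // ler_wpM2r ?cnorm_ge0 //.
  rewrite ler_wpM2l ?mulr_ge0 ?exprn_ge0 ?cexp_cst_ge0 //.
  by rewrite ler_wpM2r ?exprn_ge0 ?addr_ge0 ?w0 // lerDr.
Qed.

End symbol_class.

(** * Passage between symbol classes and iterated partial derivatives *)

Section symbol_class_pderivs.
Context {R : realType} {n : nat}.
Implicit Types (f : 'rV[R]_n -> R[i]) (w : 'rV[R]_n -> R) (s : seq 'I_n).

Lemma pderivs_rcons s i f : pderivs (rcons s i) f = pderivs s (pderiv i f).
Proof. exact: foldr_rcons. Qed.

Lemma pderivables_on_rcons A s i f : pderivables_on A (rcons s i) f <->
  pderivables_on A s (pderiv i f) /\ forall x, A x -> pderivable i f x.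
Proof.
elim: s => [|j s IH] /=; first by split=> -[].
rewrite pderivs_rcons.
split=> [[/IH[h1 h2] h3]|[[h1 h3] h2]]; split => //.
by apply/IH.
Qed.

(** [pderivs s] applies the last entry of [s] first, whence the reversal. All subsequences are asked
    for because at each entry [symb] covers both taking and skipping the derivative. *)
Lemma symb_rev s w f : (forall s', subseq s' s ->
    pderivables_on (nonzero R n) s' f /\
    forall x, x != 0 -> cnorm (pderivs s' f x) <= w x / enorm x ^+ size s') ->
  symb (rev s) w f.
Proof.
elim/last_ind: s w f => [w f /(_ [::] isT)[_ h] x x0|s i IH w f h].
  by have := h x x0; rewrite expr0 divr1.
rewrite rev_rcons /=; split.
- by apply: IH => s' ss'; apply: h; exact: subseq_trans (subseq_rcons _ _).
- have [|/pderivables_on_rcons[_ h1] _] := h (rcons [::] i).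
    by rewrite /= sub1seq mem_rcons mem_head.
  exact: h1.
- apply: IH => s' ss'.
  have [|/pderivables_on_rcons[h1 _] h2] := h (rcons s' i).
    by rewrite -!cats1 cat_subseq.
  split=> // x x0; have := h2 x x0; rewrite pderivs_rcons size_rcons exprS.
  by rewrite invfM mulrA.
Qed.

Lemma symb_pderivs s w f : symb (rev s) w f ->
  pderivables_on (nonzero R n) s f /\
  forall x, x != 0 -> cnorm (pderivs s f x) <= w x / enorm x ^+ size s.
Proof.
elim/last_ind: s w f => [w f h|s i IH w f].
  by split=> // x x0; rewrite expr0 divr1; exact: h.
rewrite rev_rcons /= => -[_ h1 /IH[h2 h3]]; split.
  by apply/pderivables_on_rcons.
move=> x x0; rewrite pderivs_rcons size_rcons exprS invfM mulrA.
exact: h3.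
Qed.

End symbol_class_pderivs.

(** * Subsequences of the derivative sequence of a multi-index *)

Section multi_index_sequences.
Context {n : nat}.
Implicit Types (alpha beta : multi_index n) (l s : seq 'I_n).

Lemma size_mi_seq alpha : size (mi_seq alpha) = mi_abs alpha.
Proof.
rewrite /mi_seq size_flatten /shape -map_comp /mi_abs.
rewrite (eq_map (g := alpha)) => [|i /=]; last by rewrite size_nseq.
by rewrite sumnE big_map big_enum.
Qed.

Lemma subseq_nseq (T : eqType) (x : T) k (s : seq T) :
  subseq s (nseq k x) -> s = nseq (size s) x.
Proof.
move=> /mem_subseq ss; apply/all_pred1P/allP => y /ss.
by rewrite mem_nseq => /andP[_].
Qed.

(** The mask selecting [s] is cut at the end of the first block: its first part shortens that block,
    and the rest is the induction hypothesis. Uniqueness of the entries of [l] lets [beta] be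
    changed at [i] alone. *)
Lemma subseq_flatten_nseq alpha l s : uniq l ->
  subseq s (flatten [seq nseq (alpha i) i | i <- l]) ->
  exists beta, s = flatten [seq nseq (beta i) i | i <- l].
Proof.
elim: l s => [s _ /= /eqP ->|i l IH s /= /andP[il ul]]; first by exists alpha.
move=> /subseqP[m sm ->].
set k := size (nseq (alpha i) i).
rewrite -(cat_take_drop k m) mask_cat; last first.
  by rewrite size_take sm size_cat -/k; case: ltngtP (leq_addr (size
    (flatten [seq nseq (alpha j) j | j <- l])) k).
have [beta ->] := IH _ ul (mask_subseq (drop k m) _).
have := subseq_nseq (mask_subseq (take k m) (nseq (alpha i) i)).
move: (mask (take k m) _) => u ->.
exists [ffun j => if j == i then size u else beta j].
rewrite ffunE eqxx; congr (_ ++ flatten _).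
apply/eq_in_map => j jl; rewrite ffunE; case: eqP => // ji.
by rewrite ji (negbTE il) in jl.
Qed.

(** Deleting entries from the ordered sequence of [alpha] leaves the ordered sequence of a smaller
    multi-index. Hence assumptions stated for multi-indices supply everything [symb_rev] asks for,
    without interchanging derivatives. *)
Lemma subseq_mi_seq alpha s : subseq s (mi_seq alpha) ->
  exists2 beta, s = mi_seq beta & (mi_abs beta <= mi_abs alpha)%N.
Proof.
move=> sa; have [beta e] := subseq_flatten_nseq (enum_uniq 'I_n) sa.
by exists beta => //; rewrite -!size_mi_seq -[mi_seq beta]e size_subseq.
Qed.

End multi_index_sequences.

(** * Difference quotients along lines that avoid the origin *)

Section lines_off_origin.
Context {R : realType}.

Lemma near_line_nonzero n (x v : 'rV[R]_n) : x != 0 ->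
  \forall h \near (0 : R), h *: v + x != 0.
Proof.
move=> /near_nonzero.
have : h *: v + x @[h --> (0 : R)] --> 0 *: v + x.
  by apply: cvgD; [apply: cvgZr_tmp; exact: cvg_id|exact: cvg_cst].
by rewrite scale0r add0r => /(_ [set y | y != 0]).
Qed.

Lemma seq_line_nonzero n (x v : 'rV[R]_n) : x != 0 -> exists u : R^nat,
  [/\ forall k, u k != 0, u @ \oo --> (0 : R) & forall k, u k *: v + x != 0].
Proof.
move=> x0; have := near_line_nonzero v x0.
move=> /(@cvg_harmonic R _)[N _ hN].
(* The shift by [N] drops the finitely many indices at which the line might meet the origin. *)
exists (fun k => harmonic (k + N)%N); split.
- by move=> k; rewrite gt_eqF // harmonic_gt0.
- by have := @cvg_harmonic R; rewrite -(cvg_shiftn N).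
- by move=> k; apply: hN; exact: leq_addl.
Qed.

Lemma derive_seq_cvg (V : normedModType R) (f : V -> R) x v (u : R^nat) :
  derivable f x v -> (forall k, u k != 0) -> u @ \oo --> (0 : R) ->
  (u k)^-1 * (f (u k *: v + x) - f x) @[k --> \oo] --> 'D_v f x.
Proof.
by move=> df u0 cu; have /cvgr_dnbhsP := df; exact.
Qed.

End lines_off_origin.

(** * Measurability of partial derivatives *)

Section measurable_pderiv.
Context {R : realType} {n : nat}.
Implicit Types (f : 'rV[R]_n -> R[i]).

(** The derivative is a pointwise limit of difference quotients, taken along a sequence of points
    off the origin, where [g] is known to be measurable in the parameter. *)
Lemma cmeasurable_pderiv_param (d : measure_display) (T : measurableType d)
    (g : T -> 'rV[R]_n -> R[i]) i x : x != 0 ->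
  (forall y, y != 0 -> cmeasurable (g ^~ y)) ->
  (forall r, pderivable i (g r) x) ->
  cmeasurable (fun r => pderiv i (g r) x).
Proof.
move=> x0 mg dg; have [u [u0 cu ux]] := seq_line_nonzero (delta_mx ord0 i) x0.
have [mx1 mx2] := mg x x0.
split.
- apply: (@measurable_fun_cvg _ _ _ _ (fun k r => (u k)^-1 *
    (complex.Re (g r (u k *: delta_mx ord0 i + x)) - complex.Re (g r x)))).
    move=> k; have [my1 my2] := mg _ (ux k).
    by apply: measurable_funM => //; exact: measurable_funB.
  by move=> r _; apply: derive_seq_cvg => //; case: (dg r).
- apply: (@measurable_fun_cvg _ _ _ _ (fun k r => (u k)^-1 *
    (complex.Im (g r (u k *: delta_mx ord0 i + x)) - complex.Im (g r x)))).
    move=> k; have [my1 my2] := mg _ (ux k).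
    by apply: measurable_funM => //; exact: measurable_funB.
  by move=> r _; apply: derive_seq_cvg => //; case: (dg r).
Qed.

Lemma measurable_rV_shift (v : 'rV[R]_n) :
  measurable_fun setT (fun x : 'rV[R]_n => v + x).
Proof.
apply/measurable_fun_rVP => j; under eq_fun do rewrite mxE.
by apply: measurable_funD => //; exact: measurable_coord.
Qed.

Lemma measurable_rV_scale (c : R) :
  measurable_fun setT (fun x : 'rV[R]_n => c *: x).
Proof.
apply/measurable_fun_rVP => j; under eq_fun do rewrite mxE.
by apply: measurable_funM => //; exact: measurable_coord.
Qed.

Lemma measurable_rV_set0 : measurable [set (0 : 'rV[R]_n)].
Proof.
rewrite (_ : [set 0] = \bigcap_(i in [set: 'I_n])
    ((fun x : 'rV[R]_n => x ord0 i) @^-1` [set 0])).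
  apply: fin_bigcap_measurable => // i _.
  by rewrite -[X in measurable X]setTI; apply: measurable_coord.
apply/seteqP; split => [x -> i _ /=|x h]; first by rewrite mxE.
by apply/rowP => i; rewrite mxE; exact: (h i).
Qed.

Lemma measurable_nonzero : measurable (nonzero R n).
Proof.
rewrite (_ : nonzero R n = ~` [set 0]).
  by apply: measurableC; exact: measurable_rV_set0.
by apply/seteqP; split => x /eqP.
Qed.

Lemma cmeasurable_pderiv f i : cmeasurable f ->
  (forall x, x != 0 -> pderivable i f x) -> cmeasurable (pderiv i f).
Proof.
move=> [mf1 mf2] df.
have key (h : 'rV[R]_n -> R) : measurable_fun setT h ->
    (forall x, x != 0 -> derivable h x (delta_mx ord0 i)) ->
    measurable_fun setT (fun x => 'D_(delta_mx ord0 i) h x).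
  move=> mh dh.
  (* At the origin the derivative may be a default value; there it suffices that every function is
     measurable on a singleton. *)
  have -> : setT = nonzero R n `|` [set 0].
    by apply/seteqP; split => x _ //; case: (eqVneq x 0) => h0; [right|left].
  apply/measurable_funU; [exact: measurable_nonzero|
    exact: measurable_rV_set0|split; last exact: measurable_fun_set1].
  apply: (@measurable_fun_cvg _ _ _ _ (fun k x => (harmonic k)^-1 *
    (h (harmonic k *: delta_mx ord0 i + x) - h x))).
    move=> k; apply: measurable_funTS; apply: measurable_funM => //.
    apply: measurable_funB => //; apply: (measurableT_comp mh).
    exact: measurable_rV_shift.
  move=> x x0; apply: derive_seq_cvg; [exact: dh| |exact: cvg_harmonic].
  by move=> k; rewrite gt_eqF // harmonic_gt0.
by split; apply: key => // x /df[].
Qed.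

Lemma cmeasurable_pderivs f s : cmeasurable f ->
  pderivables_on (nonzero R n) s f -> cmeasurable (pderivs s f).
Proof.
move=> mf; elim: s => //= i s IH [/IH h1 h2].
exact: cmeasurable_pderiv.
Qed.

End measurable_pderiv.

(** * Differentiation under the integral sign *)

Section differentiation_under_cintegral.
Context {R : realType} {n : nat}.
Variables (d : measure_display) (T : measurableType d).
Variables (mu : {measure set T -> \bar R}) (D : set T).
Hypotheses (mD : measurable D) (muD : (mu D < +oo)%E).

Lemma bounded_integrable (h : T -> R) (M : R) : measurable_fun setT h ->
  (forall r, `|h r| <= M) -> mu.-integrable D (EFin \o h).
Proof.
move=> mh hM; apply: measurable_bounded_integrable => //.
  exact: measurable_funTS.
exists M; split; first exact: num_real.
by move=> y /ltW My r _; exact: le_trans (hM r) My.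
Qed.

Lemma le_Rintegral_bounded (h : T -> R) (M : R) : measurable_fun setT h ->
  (forall r, `|h r| <= M) -> `|\int[mu]_(r in D) h r| <= M * fine (mu D).
Proof.
move=> mh hM; have ih := bounded_integrable mh hM.
apply: (le_trans (le_normr_Rintegral mD ih)).
have := @le_Rintegral _ _ _ mu D (fun r => `|h r|) (fun=> M) mD.
rewrite Rintegral_cst //; apply => //.
- by apply: bounded_integrable => [|r]; [exact: measurableT_comp|rewrite normr_id].
- apply: (@bounded_integrable _ `|M|) => //.
Qed.

Lemma cnorm_cintegral_le (h : T -> R[i]) (M : R) : cmeasurable h ->
  (forall r, cnorm (h r) <= M) ->
  cnorm (cintegral mu D h) <= 2 * fine (mu D) * M.
Proof.
move=> [m1 m2] hM; apply: (le_trans (cnorm_le_ReIm _)) => /=.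
rewrite -mulrA mulrDl mul1r mulrC lerD // le_Rintegral_bounded // => r.
  by apply: le_trans (hM r); exact: Re_le_cnorm.
by apply: le_trans (hM r); exact: Im_le_cnorm.
Qed.

(** Restriction to the line through [x] in direction [v] reduces this to one real variable. The
    dominating function is the constant [|M|], integrable because [D] has finite measure. *)
Lemma is_derive_Rintegral (V : normedModType R) (g : T -> V -> R) (x v : V)
    (delta M : R) : 0 < delta ->
  (forall h : R, `|h| < delta -> mu.-integrable D (fun r => (g r (h *: v + x))%:E)) ->
  (forall h r, `|h| < delta -> derivable (g r) (h *: v + x) v) ->
  (forall h r, `|h| < delta -> `|'D_v (g r) (h *: v + x)| <= M) ->
  is_derive x v (fun y => \int[mu]_(r in D) g r y)
    (\int[mu]_(r in D) 'D_v (g r) x).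
Proof.
move=> d0 ig dg bg; pose f (h : R) r := g r (h *: v + x).
have dI (h : R) : `]- delta, delta[%classic h -> `|h| < delta.
  by rewrite /= in_itv /= ltr_norml.
have df (h : R) r : `|h| < delta -> is_derive h 1 (f ^~ r) ('D_v (g r) (h *: v + x)).
  by move=> hd; apply: is_derive_line; exact/derivableP/dg.
have I0 : `]- delta, delta[%classic (0 : R).
  by rewrite /= in_itv /= oppr_lt0 d0.
have M0 : 0 <= `|M| by [].
have H1 (h : R) : `]- delta, delta[%classic h -> mu.-integrable D (EFin \o f h).
  by move=> /dI; exact: ig.
have H2 (h : R) r : `]- delta, delta[%classic h -> D r -> derivable (f ^~ r) h 1.
  by move=> /dI hd _; case: (df h r hd).
have H3 : mu.-integrable D (EFin \o cst `|M|).
  by apply: (@bounded_integrable _ `|M|) => // r; rewrite normr_id.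
have H4 (h : R) r : `]- delta, delta[%classic h -> D r ->
    `|partial1of2 f h r| <= cst `|M| r.
  move=> /dI hd _; rewrite partial1of2E; have [_ ->] := df h r hd.
  by apply: le_trans (bg _ _ hd) _; exact: ler_norm.
have G0 : forall r : T, 0 <= cst `|M| r by [].
apply/is_derive_lineP; apply: DeriveDef.
  exact: (derivable_under_integral mD I0 H1 H2 G0 H3 H4).
rewrite -derive1E (differentiation_under_integral mD I0 H1 H2 G0 H3 H4).
apply: eq_Rintegral => r _; rewrite partial1of2E.
by have [|_ ->] := df 0 r; rewrite ?normr0 // scale0r add0r.
Qed.

(** Induction on [l], moving each derivative inside and lowering [e] by one. The factor 2 comes from
    estimating real and imaginary parts separately. *)
Lemma symb_cintegral (l : seq 'I_n) (C e : R) (g : T -> 'rV[R]_n -> R[i]) :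
  0 <= C ->
  (forall y, y != 0 -> cmeasurable (g ^~ y)) ->
  (forall r, symb l (fun x => C * enorm x `^ e) (g r)) ->
  symb l (fun x => 2 * fine (mu D) * (C * enorm x `^ e))
    (fun x => cintegral mu D (g ^~ x)).
Proof.
move=> C0; elim: l e g => [e g mg sg x x0|i l IH e g mg /all_and3 [s1 s2 s3]].
  by apply: cnorm_cintegral_le; [exact: mg|move=> r; exact: (sg r x x0)].
pose v : 'rV[R]_n := delta_mx ord0 i.
have s3' r : symb l (fun x => C * enorm x `^ (e - 1)) (pderiv i (g r)).
  by apply: symb_le (s3 r) => x x0; rewrite enorm_powRB1 // mulrA.
have DI x : x != 0 -> is_pderiv i (fun y => cintegral mu D (g ^~ y)) x
    (cintegral mu D (fun r => pderiv i (g r) x)).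
  move=> x0.
  (* The weight of the derivative is continuous along the line, so near [h = 0] it stays below its
     value at [x] plus one. That number is the dominating constant [M], uniform in [r]. *)
  have : \forall h \near (0 : R), h *: v + x != 0 /\
      C * enorm (h *: v + x) `^ (e - 1) < C * enorm x `^ (e - 1) + 1.
    near=> h; split; near: h; first exact: near_line_nonzero.
    have : {for (0 : R), continuous (fun h : R => C * enorm (h *: v + x) `^ (e - 1))}.
      apply/differentiable_continuous/derivable1_diffP.
      apply: (@derivableM _ _ (cst C)); first exact: derivable_cst.
      have [dx _] := is_derive_enorm_powR i (e - 1) x0.
      exact: (derivable1P _ _ _).1 dx.
    by move=> /cvgr_lt; apply; rewrite scale0r add0r ltrDl.
  move=> [delta /= d0 hd].
  have {}hd (h : R) : `|h| < delta -> h *: v + x != 0 /\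
      C * enorm (h *: v + x) `^ (e - 1) < C * enorm x `^ (e - 1) + 1.
    by move=> hh; apply: hd; rewrite /ball /= sub0r normrN.
  pose M := C * enorm x `^ (e - 1) + 1.
  have bd r h : `|h| < delta -> cnorm (pderiv i (g r) (h *: v + x)) <= M.
    move=> /hd[hn /ltW hM]; apply: le_trans hM.
    exact: (symb_bound (s3' r)).
  have bd0 r h : `|h| < delta ->
      cnorm (g r (h *: v + x)) <= C * enorm (h *: v + x) `^ e.
    by move=> /hd[hn _]; exact: (symb_bound (s1 r)).
  split; apply: (@is_derive_Rintegral _ _ _ _ delta M) => //.
  - move=> h hh; apply: (@bounded_integrable (fun r => complex.Re (g r (h *: v + x)))
      (C * enorm (h *: v + x) `^ e)); first by case: (mg _ (hd h hh).1).
    by move=> r; apply: le_trans (bd0 r h hh); exact: Re_le_cnorm.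
  - by move=> h r /hd[hn _]; case: (s2 r _ hn).
  - move=> h r /(bd r); apply: le_trans.
    exact: (Re_le_cnorm (pderiv i (g r) (h *: v + x))).
  - move=> h hh; apply: (@bounded_integrable (fun r => complex.Im (g r (h *: v + x)))
      (C * enorm (h *: v + x) `^ e)); first by case: (mg _ (hd h hh).1).
    by move=> r; apply: le_trans (bd0 r h hh); exact: Im_le_cnorm.
  - by move=> h r /hd[hn _]; case: (s2 r _ hn).
  - move=> h r /(bd r); apply: le_trans.
    exact: (Im_le_cnorm (pderiv i (g r) (h *: v + x))).
split; [exact: IH|by move=> x /DI /is_pderivW|].
have mg' y : y != 0 -> cmeasurable (fun r => pderiv i (g r) y).
  by move=> y0; apply: cmeasurable_pderiv_param => // r; exact: s2.
apply: symb_eq (symb_le _ (IH _ _ mg' s3')) => x x0.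
  by rewrite (is_pderivE (DI x x0)).
by rewrite enorm_powRB1 // !mulrA.
Unshelve. all: by end_near. Qed.

End differentiation_under_cintegral.

(** * Elementary estimates for powers and exponentials *)

Section power_estimates.
Context {R : realType}.
Implicit Types x y e : R.

Lemma le0_powR x y e : 0 < x -> x <= y -> e <= 0 -> y `^ e <= x `^ e.
Proof.
move=> x0 xy e0; have y0 := lt_le_trans x0 xy.
rewrite -[e]opprK !(powRN _ (- e)) lef_pV2 ?posrE ?powR_gt0 //.
by apply: ge0_ler_powR; rewrite ?nnegrE ?oppr_ge0 // ltW.
Qed.

Lemma powR_exprn x e k : 0 < x -> (x ^+ k) `^ e = (x `^ e) ^+ k.
Proof.
move=> x0; rewrite -powR_mulrn ?ltW // -powRrM mulrC powRrM powR_mulrn //.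
exact: powR_ge0.
Qed.

Lemma lt_expr2 x : exists k, x < 2 ^+ k.
Proof.
exists (Num.Def.archi_bound `|x|); apply: le_lt_trans (ler_norm x) _.
apply: lt_trans (archi_boundP (normr_ge0 x)) _.
by rewrite -natrX ltr_nat ltn_expl.
Qed.

(** Take the least [k] satisfying the first inequality; its minimality, or [x <= 1] when [k = 0],
    gives the second. *)
Lemma dyadic_small x : 0 < x -> x <= 1 ->
  exists k, 2^-1 ^+ k.+1 < x /\ x <= 2^-1 ^+ k.
Proof.
move=> x0 x1.
have ex : exists k, 2^-1 ^+ k.+1 < x.
  have [k hk] := lt_expr2 x^-1; exists k.
  rewrite exprVn invf_plt ?posrE ?exprn_gt0 //; apply: lt_le_trans hk _.
  by rewrite exprS ler_peMl ?exprn_ge0 // ler1n.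
case: (ex_minnP ex) => k hk hmin; exists k; split => //.
case: k hk hmin => [|k] hk hmin; first by rewrite expr0.
by rewrite leNgt; apply/negP => /hmin; rewrite ltnn.
Qed.

Lemma dyadic_large x : 1 <= x ->
  exists k, x <= 2 ^+ k /\ 2 ^+ k <= 2 * x.
Proof.
move=> x1; have ex : exists k, x <= 2 ^+ k.
  by have [k /ltW hk] := lt_expr2 x; exists k.
case: (ex_minnP ex) => k hk hmin; exists k; split => //.
case: k hk hmin => [|k] hk hmin.
  by rewrite expr0; lra.
rewrite exprS ler_pM2l //; apply/ltW; rewrite ltNge; apply/negP => /hmin.
by rewrite ltnn.
Qed.

(** For positive [m], write [e^y = (e^(y/m))^m] and use [e^(y/m) >= y/m]. *)
Lemma exprn_le_expR m y : 0 <= y -> y ^+ m <= m%:R ^+ m * expR y.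
Proof.
case: m => [|m] y0.
  by rewrite !expr0 mul1r -expR0 ler_expR.
have m0 : 0 < m.+1%:R :> R by [].
have -> : expR y = expR (y / m.+1%:R) ^+ m.+1.
  by rewrite -expRM_natl mulrC divfK // gt_eqF.
rewrite -exprMn lerXn2r ?nnegrE // ?mulr_ge0 ?expR_ge0 //.
rewrite mulrC -ler_pdivrMr //; apply: le_trans (expR_ge1Dx _).
by rewrite lerDr.
Qed.

Lemma powR_expR_decay (gamma nu p q : R) (k : nat) : 0 < gamma -> 0 < nu ->
  exists2 C, 0 <= C & forall x, 1 <= x ->
  x `^ p * (1 + nu^-1 * x `^ gamma) ^+ k * expR (- (nu * x `^ gamma)) <=
  C * x `^ (- q).
Proof.
(* [m] is large enough that [x^(gamma m)] beats [x^(p + q + gamma k)] for [x >= 1]; the exponential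
   then absorbs [x^(gamma m)] by [exprn_le_expR]. *)
move=> g0 n0; pose m := Num.Def.archi_bound `|(p + q + gamma * k%:R) / gamma|.
have hm : p + q + gamma * k%:R <= gamma * m%:R.
  rewrite [gamma * m%:R]mulrC -ler_pdivrMr //; apply: le_trans (ler_norm _) _.
  exact: ltW (archi_boundP (normr_ge0 _)).
exists ((1 + nu^-1) ^+ k * (nu^-1 ^+ m * m%:R ^+ m)) => [|x x1].
  by rewrite !mulr_ge0 ?exprn_ge0 ?addr_ge0 ?invr_ge0 // ltW.
have x0 : 0 < x by apply: lt_le_trans x1.
have xn0 : x != 0 by rewrite gt_eqF.
have g1 : 1 <= x `^ gamma.
  by rewrite -(powRr0 x); apply: ler_powR => //; exact: ltW.
have i0 : 0 <= nu^-1 by rewrite invr_ge0 ltW.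
have e0 : 0 <= expR (- (nu * x `^ gamma)) := expR_ge0 _.
have h1 : (1 + nu^-1 * x `^ gamma) ^+ k <= (1 + nu^-1) ^+ k * x `^ (gamma * k%:R).
  rewrite powRrM powR_mulrn ?powR_ge0 // -exprMn lerXn2r ?nnegrE //.
  - by rewrite addr_ge0 // mulr_ge0 // powR_ge0.
  - by rewrite mulr_ge0 ?powR_ge0 // addr_ge0.
  - by rewrite mulrDl mul1r lerD2r.
apply: le_trans (ler_wpM2r e0 (ler_wpM2l (powR_ge0 _ _) h1)) _.
have h2 : x `^ p * x `^ (gamma * k%:R) <= x `^ (- q) * (x `^ gamma) ^+ m.
  rewrite -powR_mulrn ?powR_ge0 // -powRrM -!powRD ?xn0 ?implybT //.
  apply: ler_powR => //; move: hm; lra.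
have h3 : (x `^ gamma) ^+ m * expR (- (nu * x `^ gamma)) <= nu^-1 ^+ m * m%:R ^+ m.
  have y0 : 0 <= nu * x `^ gamma by rewrite mulr_ge0 ?powR_ge0 // ltW.
  rewrite expRN ler_pdivrMr ?expR_gt0 //.
  have -> : (x `^ gamma) ^+ m = nu^-1 ^+ m * (nu * x `^ gamma) ^+ m.
    by rewrite -exprMn mulrA mulVf ?mul1r // gt_eqF.
  by rewrite -mulrA ler_wpM2l ?exprn_ge0 // exprn_le_expR.
rewrite mulrCA -[X in _ <= X]mulrA -[X in X <= _]mulrA.
rewrite ler_wpM2l ?exprn_ge0 ?addr_ge0 //.
apply: le_trans (ler_wpM2r e0 h2) _.
by rewrite -mulrA mulrC ler_wpM2r ?powR_ge0.
Qed.

Lemma powR_expR_small (gamma nu p x : R) (k : nat) : 0 < gamma -> 0 < nu ->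
  0 < x -> x <= 1 ->
  x `^ p * (1 + nu^-1 * x `^ gamma) ^+ k * expR (- (nu * x `^ gamma)) <=
  (1 + nu^-1) ^+ k * x `^ Num.min p 0.
Proof.
move=> g0 n0 x0 x1.
have g1 : x `^ gamma <= 1.
  by rewrite -[X in _ <= X](powRr0 x); apply: ger_powR; rewrite ?x0 // ltW.
have i0 : 0 <= nu^-1 by rewrite invr_ge0 ltW.
have a0 : 0 <= 1 + nu^-1 * x `^ gamma by rewrite addr_ge0 // mulr_ge0 ?powR_ge0.
rewrite -[X in _ <= X]mulr1 ler_pM ?mulr_ge0 ?exprn_ge0 ?powR_ge0 ?expR_ge0 //.
  rewrite mulrC ler_pM ?exprn_ge0 ?powR_ge0 //.
    rewrite lerXn2r ?nnegrE ?addr_ge0 ?mulr_ge0 ?powR_ge0 // lerD2l.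
    by rewrite ler_piMr.
  by apply: ger_powR; rewrite ?x0 // ge_min lexx.
by rewrite -expR0 ler_expR oppr_le0 mulr_ge0 ?powR_ge0 // ltW.
Qed.

End power_estimates.

(** * Integrable dominating functions built from dyadic cubes *)

Section dyadic_domination.
Context {R : realType} {n : nat}.
Local Notation mu := (lebesgue_rV R n).

Definition cube (r : R) : set 'rV[R]_n :=
  [set x | forall i, `[- r, r]%classic (x ord0 i)].

Lemma measurable_cube r : measurable (cube r).
Proof.
rewrite (_ : cube r = \bigcap_(i in [set: 'I_n])
    ((fun x : 'rV[R]_n => x ord0 i) @^-1` `[- r, r]%classic)).
  apply: fin_bigcap_measurable => // i _.
  by rewrite -[X in measurable X]setTI; apply: measurable_coord.
by apply/seteqP; split => x /= h i; [move=> _; exact: h|exact: (h i)].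
Qed.

Lemma lebesgue_cube r : 0 < r -> mu (cube r) = ((2 * r) ^+ n)%:E.
Proof.
move=> r0; rewrite (@lebesgue_rV_box R n (fun=> `[- r, r]%classic)) //.
rewrite (eq_bigr (fun=> (2 * r)%:E)) => [|i _].
  by rewrite prodEFin big_const_ord iter_mulr_1.
rewrite lebesgue_measure_itv /= lte_fin gt0_cp //.
by rewrite -EFinB opprK mulr2n mulrDl mul1r.
Qed.

Lemma enorm_cube x r : enorm x <= r -> cube r x.
Proof.
move=> xr i /=; rewrite in_itv /= -ler_norml.
exact: le_trans (coord_le_enorm _ _) xr.
Qed.

Lemma nneseries_geometric (a z : R) : 0 <= a -> 0 < z -> z < 1 ->
  (\sum_(0 <= k <oo) (a * z ^+ k)%:E < +oo)%E.
Proof.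
move=> a0 z0 z1; apply: (@le_lt_trans _ _ (a / (1 - z))%:E); last exact: ltry.
apply: lime_le.
  by apply: is_cvg_nneseries => k _ _; rewrite lee_fin mulr_ge0 ?exprn_ge0 // ltW.
apply: nearW => k; rewrite sumEFin lee_fin.
by apply: geometric_le_lim => //; rewrite gtr0_norm.
Qed.

(** [G] is the sum of [rho^(e k)] times the indicator of the cube of half-side [rho^k]. Its integral
    is a geometric series of ratio [rho^(e+n)], and its [k]-th term alone gives the lower bound.
    Both [rho < 1], for the origin, and [rho > 1], for infinity, are used. *)
Lemma dyadic_dominator (rho e : R) : 0 < rho -> rho `^ (e + n%:R) < 1 ->
  exists G : 'rV[R]_n -> \bar R,
  [/\ measurable_fun setT G, forall x, (0 <= G x)%E,
      (\int[mu]_x G x < +oo)%E &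
      forall x k, enorm x <= rho ^+ k -> (((rho `^ e) ^+ k)%:E <= G x)%E].
Proof.
move=> r0 r1.
pose f k x : \bar R := ((rho `^ e) ^+ k * \1_(cube (rho ^+ k)) x)%:E.
have f0 k x : (0 <= f k x)%E.
  by rewrite lee_fin mulr_ge0 ?exprn_ge0 ?powR_ge0.
have mf k : measurable_fun setT (f k).
  apply/measurable_EFinP; apply: measurable_funM => //.
  by apply: measurable_indic; exact: measurable_cube.
exists (fun x => \sum_(0 <= k <oo) f k x)%E; split.
- by apply: ge0_emeasurable_sum => // k x _ _.
- by move=> x; exact: nneseries_ge0.
- rewrite integral_nneseries //.
  rewrite (eq_eseriesr (g := fun k => (2 ^+ n * (rho `^ (e + n%:R)) ^+ k)%:E)).
    by apply: nneseries_geometric; rewrite ?exprn_ge0 ?powR_gt0.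
  move=> k _; rewrite /f; under eq_integral do rewrite EFinM.
  have mI : measurable_fun setT
      (fun x : 'rV[R]_n => (\1_(cube (rho ^+ k)) x : R)%:E).
    by apply/measurable_EFinP; apply: measurable_indic; exact: measurable_cube.
  have c0 : (0 <= ((rho `^ e) ^+ k)%:E)%E by rewrite lee_fin exprn_ge0 ?powR_ge0.
  rewrite (ge0_integralZl mu measurableT mI _ c0); last first.
    by move=> x _; rewrite lee_fin.
  rewrite integral_indic //; last exact: measurable_cube.
  rewrite setIT [X in (_ * X)%E]lebesgue_cube ?exprn_gt0 // -EFinM; congr EFin.
  have rn : rho != 0 by rewrite gt_eqF.
  rewrite powRD ?rn ?implybT // (powR_mulrn _ (ltW r0)) !exprMn.
  by rewrite mulrCA -!exprM mulnC.
- move=> x k xk; apply: le_trans (nneseries_lim_ge k.+1 _) => //.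
  rewrite big_nat_recr //= -[X in (X <= _)%E]add0e leeD //.
    by apply: sume_ge0.
  by rewrite lee_fin indicE mem_set ?mulr1 //; exact: enorm_cube.
Qed.

Lemma powR_expR_dominator (gamma nu p : R) (k : nat) :
  (0 < n)%N -> 0 < gamma -> 0 < nu -> - n%:R < p ->
  exists G : 'rV[R]_n -> \bar R,
  [/\ measurable_fun setT G, forall x, (0 <= G x)%E,
      (\int[mu]_x G x < +oo)%E &
      forall x, x != 0 -> ((enorm x `^ p * (1 + nu^-1 * enorm x `^ gamma) ^+ k *
        expR (- (nu * enorm x `^ gamma)))%:E <= G x)%E].
Proof.
(* Near the origin the exponent is replaced by [e <= 0], still above [-n], so that powers decrease
   in [|x|]. At infinity any decay faster than [|x|^(-n)] will do, and [q = n + 1] is taken. *)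
move=> n_gt0 g0 n0 np; pose e := Num.min p 0; pose q : R := n.+1%:R.
have e0 : e <= 0 by rewrite /e ge_min lexx orbT.
have [|//|G1 [mG1 G10 iG1 hG1]] := @dyadic_dominator 2^-1 e _ _; first 2 last.
- have [|//|G2 [mG2 G20 iG2 hG2]] := @dyadic_dominator 2 (- q) _ _; first 2 last.
    have [C2 C20 hC2] := powR_expR_decay p q k g0 n0.
    (* The last factors of [C1] and [C3] pay for comparing [|x|] with a power of two up to a factor
       2. *)
    pose C1 : R := (1 + nu^-1) ^+ k * 2^-1 `^ e.
    have C10 : 0 <= C1.
      by rewrite mulr_ge0 ?exprn_ge0 ?powR_ge0 // addr_ge0 // invr_ge0 ltW.
    pose C3 : R := C2 * 2 `^ q.
    have C30 : 0 <= C3 by rewrite mulr_ge0 ?powR_ge0.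
    have mZ (C : R) (G : 'rV[R]_n -> \bar R) : measurable_fun setT G ->
      measurable_fun setT (fun x => C%:E * G x)%E by exact: measurable_funeM.
    exists (fun x => C1%:E * G1 x + C3%:E * G2 x)%E; split.
    + by apply: emeasurable_funD; exact: mZ.
    + by move=> x; rewrite adde_ge0 // mule_ge0.
    + rewrite ge0_integralD //; [|by move=> x _; rewrite mule_ge0|exact: mZ|
        by move=> x _; rewrite mule_ge0|exact: mZ].
      rewrite !ge0_integralZl //.
      by rewrite lte_add_pinfty // lte_mul_pinfty // ?lee_fin // ?fin_numE.
    + move=> x x0; have xp := enorm_gt0 x0.
      have [x1|/ltW x1] := leP (enorm x) 1.
        have [j [j1 j2]] := dyadic_small xp x1.
        apply: le_trans (leeDl _ _); last by rewrite mule_ge0.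
        apply: le_trans (lee_wpmul2l _ (hG1 x j j2)) => //.
        rewrite -EFinM lee_fin.
        apply: le_trans (powR_expR_small p k g0 n0 xp x1) _.
        rewrite /C1 -mulrA ler_wpM2l ?exprn_ge0 ?addr_ge0 ?invr_ge0 ?(ltW n0) //.
        rewrite -exprS -powR_exprn //; apply: le0_powR => //.
        exact: ltW.
      have [j [j1 j2]] := dyadic_large x1.
      apply: le_trans (leeDr _ _); last by rewrite mule_ge0.
      apply: le_trans (lee_wpmul2l _ (hG2 x j j1)) => //.
      rewrite -EFinM lee_fin; apply: le_trans (hC2 _ x1) _.
      rewrite /C3 -mulrA ler_wpM2l // -powR_exprn //.
      have : (2 * enorm x) `^ (- q) <= (2 ^+ j) `^ (- q).
        by apply: le0_powR; rewrite ?exprn_gt0 // oppr_le0.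
      rewrite powRM ?(ltW xp) // => h.
      have := ler_wpM2l (powR_ge0 2 q) h; rewrite mulrA -powRD ?implybT //.
        by rewrite subrr powRr0 mul1r.
      by apply/implyP => _; rewrite gt_eqF.
  + by [].
  + rewrite /q -[n.+1%:R]natr1 opprD addrAC addNr add0r.
    by rewrite powR_inv1 // invf_lt1 // ltr1n.
- by rewrite invr_gt0.
- have en : 0 < e + n%:R.
    by rewrite -ltrBlDr sub0r lt_min np oppr_lt0 ltr0n.
  rewrite -powR_inv1 // -powRrM mulN1r powRN invf_lt1 ?powR_gt0 //.
  have := @gt0_ltr_powR R _ en 1 2; rewrite powR1; apply.
  - by rewrite nnegrE.
  - by rewrite nnegrE.
  - by rewrite ltr1n.
Qed.

End dyadic_domination.

(** * Measurability of complex-valued functions and of parametric integrals *)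

Section cmeasurable_operations.
Context {R : realType} (d : measure_display) (T : measurableType d).
Implicit Types f g : T -> R[i].

Lemma cmeasurable_cst (c : R[i]) : cmeasurable (fun _ : T => c).
Proof. by split; exact: measurable_cst. Qed.

Lemma cmeasurable_real (f : T -> R) : measurable_fun setT f ->
  cmeasurable (fun x => (f x)%:C).
Proof. by move=> mf; split => //=; exact: measurable_cst. Qed.

Lemma cmeasurableM f g : cmeasurable f -> cmeasurable g ->
  cmeasurable (fun x => f x * g x).
Proof.
move=> [f1 f2] [g1 g2]; split.
- rewrite (_ : (fun x => _) = (fun x => complex.Re (f x) * complex.Re (g x) -
    complex.Im (f x) * complex.Im (g x))).
    by apply: measurable_funB; exact: measurable_funM.
  by apply/funext => x; case: (f x) (g x) => ? ? [].
- rewrite (_ : (fun x => _) = (fun x => complex.Re (f x) * complex.Im (g x) +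
    complex.Im (f x) * complex.Re (g x))).
    by apply: measurable_funD; exact: measurable_funM.
  by apply/funext => x; case: (f x) (g x) => ? ? [].
Qed.

Lemma cmeasurableX f k : cmeasurable f -> cmeasurable (fun x => f x ^+ k).
Proof.
move=> mf; elim: k => [|k IH]; first exact: cmeasurable_cst.
under eq_fun do rewrite exprS.
exact: cmeasurableM.
Qed.

Lemma cmeasurable_cexp f : cmeasurable f -> cmeasurable (fun x => cexp (f x)).
Proof.
move=> [f1 f2]; apply: cmeasurableM.
  by apply: cmeasurable_real; exact: measurableT_comp.
split => /=.
- apply: (measurableT_comp _ f2); apply: continuous_measurable_fun.
  exact: continuous_cos.
- apply: (measurableT_comp _ f2); apply: continuous_measurable_fun.
  exact: continuous_sin.
Qed.

End cmeasurable_operations.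

Section measurable_parametric_integral.
Context {R : realType}.
Variables (d1 d2 : measure_display) (T1 : measurableType d1).
Variables (T2 : measurableType d2) (m1 : {sigma_finite_measure set T1 -> \bar R}).
Variables (D : set T1) (mD : measurable D).

(** Multiplication by the indicator of [D] turns this into an integral over a full section, whose
    measurability belongs to Tonelli's theorem. *)
Let measurable_ge0_integral_param (h : T1 * T2 -> R) :
  measurable_fun setT h -> (forall p, 0 <= h p) ->
  measurable_fun setT (fun y => \int[m1]_(x in D) (h (x, y))%:E)%E.
Proof.
move=> mh h0; pose F (p : T1 * T2) := (h p * \1_D p.1)%:E.
have -> : (fun y => \int[m1]_(x in D) (h (x, y))%:E)%E = fubini_G m1 F.
  apply/funext => y; rewrite /fubini_G [LHS]integral_mkcond.
  congr (integral _ _ _); apply/funext => x.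
  rewrite /F patchE indicE; case: ifP => _ /=; by rewrite ?mulr1 ?mulr0.
apply: measurable_fun_fubini_tonelli_G => [|p]; last first.
  by rewrite lee_fin mulr_ge0.
apply/measurable_EFinP; apply: measurable_funM => //.
by apply: (measurableT_comp _ measurable_fst); exact: measurable_indic.
Qed.

Lemma measurable_Rintegral_param (h : T1 * T2 -> R) :
  measurable_fun setT h ->
  measurable_fun setT (fun y => \int[m1]_(x in D) h (x, y)).
Proof.
move=> mh.
have mp := measurable_ge0_integral_param (measurable_funrpos mh) (funrpos_ge0 h).
have mn := measurable_ge0_integral_param (measurable_funrneg mh) (funrneg_ge0 h).
rewrite /Rintegral; apply: (measurableT_comp (fine_measurable measurableT)).
under eq_fun do rewrite integralE.
apply: emeasurable_funB.
- rewrite (_ : (fun y => _) = (fun y => \int[m1]_(x in D) (h^\+ (x, y))%:E)%E) //.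
  by apply/funext => y; apply: eq_integral => x _; rewrite funeposE /funrpos EFin_max.
- rewrite (_ : (fun y => _) = (fun y => \int[m1]_(x in D) (h^\- (x, y))%:E)%E) //.
  by apply/funext => y; apply: eq_integral => x _; rewrite funenegE /funrneg EFin_max.
Qed.

End measurable_parametric_integral.

(** * Measurability of the function that [q_hat] differentiates *)

Section measurable_q_base.
Context {R : realType} {d : nat}.
Variables (gamma : R) (psi : R -> 'rV[R]_d -> R[i]).
Hypothesis mpsi : cmeasurable (fun p : R * 'rV[R]_d => psi p.1 p.2).

Lemma cmeasurable_xsection (t : R) : cmeasurable (psi t).
Proof.
have [m1 m2] := mpsi.
have mt : measurable_fun setT (fun x : 'rV[R]_d => (t, x)).
  exact: measurable_pair1.
by split; [exact: (measurableT_comp m1 mt)|exact: (measurableT_comp m2 mt)].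
Qed.

Lemma cmeasurable_ysection (x : 'rV[R]_d) :
  cmeasurable (fun r : measurableTypeR R => psi r x).
Proof.
have [m1 m2] := mpsi.
have mt : measurable_fun setT (fun r : measurableTypeR R => (r : R, x)).
  exact: measurable_pair2.
by split; [exact: (measurableT_comp m1 mt)|exact: (measurableT_comp m2 mt)].
Qed.

Lemma cmeasurable_comp (f : 'rV[R]_d -> R[i]) (h : 'rV[R]_d -> 'rV[R]_d) :
  measurable_fun setT h -> cmeasurable f -> cmeasurable (fun x => f (h x)).
Proof.
move=> mh [m1 m2].
by split; [exact: (measurableT_comp m1 mh)|exact: (measurableT_comp m2 mh)].
Qed.

Lemma measurable_dot (y : 'rV[R]_d) :
  measurable_fun setT (fun x : 'rV[R]_d => dot x y).
Proof.
apply: measurable_sum => i.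
by apply: measurable_funM => //; exact: measurable_coord.
Qed.

Lemma measurable_enorm_powR (b : R) :
  measurable_fun setT (fun x : 'rV[R]_d => enorm x `^ b).
Proof.
under eq_fun do rewrite enorm_powR.
apply: (measurableT_comp (measurable_powR (b / 2))).
apply: measurable_sum => i.
by apply: measurable_funM => //; exact: measurable_coord.
Qed.

Lemma cmeasurable_q_base a b s t : cmeasurable (q_base gamma psi a b s t).
Proof.
pose c := (t - s) `^ (- gamma^-1).
have mc := @measurable_rV_scale R d c.
apply: cmeasurableM; first apply: cmeasurableM.
- apply: cmeasurableX; apply: cmeasurableM; first exact: cmeasurable_cst.
  exact: (cmeasurable_comp mc (cmeasurable_xsection t)).
- by apply: cmeasurable_real; exact: measurable_enorm_powR.
- apply: cmeasurable_cexp.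
  have [m1 m2] := mpsi.
  have mcp : measurable_fun setT
      (fun p : measurableTypeR R * 'rV[R]_d => (p.1 : R, c *: p.2)).
    apply/measurable_fun_pairP; split; first exact: measurable_fst.
    exact: (measurableT_comp mc measurable_snd).
  split.
  + exact: (@measurable_Rintegral_param _ _ _ _ _ (@lebesgue_measure R) `[s, t]
      (measurable_itv _) _ (measurableT_comp m1 mcp)).
  + exact: (@measurable_Rintegral_param _ _ _ _ _ (@lebesgue_measure R) `[s, t]
      (measurable_itv _) _ (measurableT_comp m2 mcp)).
Qed.

End measurable_q_base.

(** * Dominated functions and their inverse Fourier transforms *)

Section inverse_fourier_bound.
Context {R : realType} {n : nat}.
Local Notation mu := (lebesgue_rV R n).

(** The origin is a box with a side of length zero; in dimension 0 there is no side and the measure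
    is a Dirac mass. *)
Lemma lebesgue_rV_origin : (0 < n)%N -> mu [set 0] = 0%E.
Proof.
move=> n0; have := @lebesgue_rV_box R n (fun=> [set 0]) (fun=> measurable_set1 _).
rewrite (_ : [set x | _] = [set 0]) => [->|]; last first.
  apply/seteqP; split => [x h|x -> i]; last by rewrite mxE.
  by apply/rowP => i; rewrite mxE; exact: (h i).
by rewrite (bigD1 (Ordinal n0)) //= lebesgue_measure_set1 mul0e.
Qed.

Lemma ae_nonzero : (0 < n)%N -> {ae mu, forall x, x != 0}.
Proof.
move=> n0; exists [set 0]; split; [exact: measurable_rV_set0|
  exact: lebesgue_rV_origin|].
by move=> x /= /negP; rewrite negbK => /eqP.
Qed.

Section dominated.
Variable G : 'rV[R]_n -> \bar R.
Hypotheses (mG : measurable_fun setT G) (G0 : forall x, (0 <= G x)%E).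
Hypothesis (iG : (\int[mu]_x G x < +oo)%E).
Hypothesis (n0 : (0 < n)%N).

Let le_integral_dominated (h : 'rV[R]_n -> R) : measurable_fun setT h ->
  (forall x, x != 0 -> (`|h x|%:E <= G x)%E) ->
  (\int[mu]_x `|(h x)%:E| <= \int[mu]_x G x)%E.
Proof.
move=> mh hG; apply: ae_ge0_le_integral => //.
- by apply: measurableT_comp => //; exact/measurable_EFinP.
- apply: filterS (ae_nonzero n0) => x x0 _.
  by rewrite abse_EFin; exact: hG.
Qed.

Lemma dominated_integrable (h : 'rV[R]_n -> R) : measurable_fun setT h ->
  (forall x, x != 0 -> (`|h x|%:E <= G x)%E) ->
  mu.-integrable setT (EFin \o h).
Proof.
move=> mh hG; apply/integrableP; split; first exact/measurable_EFinP.
exact: le_lt_trans (le_integral_dominated mh hG) iG.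
Qed.

Lemma dominated_Rintegral_le (h : 'rV[R]_n -> R) : measurable_fun setT h ->
  (forall x, x != 0 -> (`|h x|%:E <= G x)%E) ->
  `|\int[mu]_x h x| <= fine (\int[mu]_x G x).
Proof.
move=> mh hG; have ih := dominated_integrable mh hG.
rewrite -lee_fin fineK; last first.
  by rewrite ge0_fin_numE // integral_ge0.
rewrite (EFin_normr_Rintegral _ ih) //.
apply: le_trans (le_integral_dominated mh hG).
by apply: le_abse_integral => //; exact/measurable_EFinP.
Qed.

Lemma dominated_cintegrable (f : 'rV[R]_n -> R[i]) : cmeasurable f ->
  (forall x, x != 0 -> ((cnorm (f x))%:E <= G x)%E) -> cintegrable mu setT f.
Proof.
move=> [m1 m2] fG; split; apply: dominated_integrable => // x x0.
  by apply: le_trans (fG x x0); rewrite lee_fin Re_le_cnorm.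
by apply: le_trans (fG x x0); rewrite lee_fin Im_le_cnorm.
Qed.

Lemma dominated_inv_fourier (f : 'rV[R]_n -> R[i]) : cmeasurable f ->
  (forall x, x != 0 -> ((cnorm (f x))%:E <= G x)%E) ->
  forall x, cnorm (inv_fourier f x) <=
    `|(2 * pi) ^- n| * (2 * fine (\int[mu]_x G x)).
Proof.
move=> mf fG x; rewrite /inv_fourier cnormM cnormR ler_wpM2l //.
have [m1 m2] : cmeasurable (fun xi => cexp (0 +i* dot xi x) * f xi).
  apply: cmeasurableM => //; apply: cmeasurable_cexp; split => /=.
    exact: measurable_cst.
  exact: measurable_dot.
have bd xi : xi != 0 -> ((cnorm (cexp (0 +i* dot xi x) * f xi))%:E <= G xi)%E.
  by rewrite cnormM cnorm_cexp /= expR0 mul1r; exact: fG.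
apply: (le_trans (cnorm_le_ReIm _)); rewrite mulrDl mul1r lerD //=.
  apply: dominated_Rintegral_le => // xi /bd; apply: le_trans.
  by rewrite lee_fin Re_le_cnorm.
apply: dominated_Rintegral_le => // xi /bd; apply: le_trans.
by rewrite lee_fin Im_le_cnorm.
Qed.

End dominated.

(** The oscillating factor has modulus 1, so the integral of the dominating function controls the
    transform. As [N] is fixed before [f], the bound will be uniform in [psi], [s] and [t]. *)
Lemma powR_expR_inv_fourier (gamma nu p C : R) (k : nat) :
  (0 < n)%N -> 0 < gamma -> 0 < nu -> - n%:R < p -> 0 <= C ->
  exists2 N, 0 <= N & forall f : 'rV[R]_n -> R[i], cmeasurable f ->
  (forall x, x != 0 -> cnorm (f x) <= C * (enorm x `^ p *
    (1 + nu^-1 * enorm x `^ gamma) ^+ k * expR (- (nu * enorm x `^ gamma)))) ->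
  cintegrable mu setT f /\ forall x, cnorm (inv_fourier f x) <= N.
Proof.
move=> n0 g0 nu0 hp C0.
have [G [mG G0 iG hG]] := powR_expR_dominator k n0 g0 nu0 hp.
pose G' x := (C%:E * G x)%E.
have mG' : measurable_fun setT G' by exact: measurable_funeM.
have G'0 x : (0 <= G' x)%E by rewrite mule_ge0.
have iG' : (\int[mu]_x G' x < +oo)%E.
  by rewrite ge0_integralZl // lte_mul_pinfty // ?lee_fin.
exists (`|(2 * pi) ^- n| * (2 * fine (\int[mu]_x G' x))) => [|f mf hf].
  by rewrite !mulr_ge0 // fine_ge0 // integral_ge0.
have fG x : x != 0 -> ((cnorm (f x))%:E <= G' x)%E.
  move=> x0; apply: le_trans (lee_wpmul2l _ (hG x x0)); last by rewrite lee_fin.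
  by rewrite -EFinM lee_fin; exact: hf.
split; first exact: (dominated_cintegrable mG').
exact: (dominated_inv_fourier mG').
Qed.

End inverse_fourier_bound.

(** * Bounds on the rescaled symbol, its time integral and [q_hat] *)

Section scaled_symbol.
Context {R : realType} {d : nat}.
Variables (gamma nu : R) (psi : R -> 'rV[R]_d -> R[i]).
Hypotheses (gamma_gt0 : 0 < gamma) (nu_gt0 : 0 < nu).
Hypothesis hpsi : symbol_assumption gamma nu psi.
Variables s t : R.
Hypothesis st : s < t.
Variable alpha : multi_index d.
Hypothesis halpha : (mi_abs alpha <= (d %/ 2).+1)%N.

Let l := rev (mi_seq alpha).
Let n := mi_abs alpha.
Let tau := t - s.
Let c := (t - s) `^ (- gamma^-1).
Let y (x : 'rV[R]_d) := enorm x `^ gamma.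
Let I (x : 'rV[R]_d) := cintegral lebesgue_measure `[s, t]
  (fun r : measurableTypeR R => psi r (c *: x)).

Let size_l : size l = n.
Proof. by rewrite size_rev size_mi_seq. Qed.

Let tau_gt0 : 0 < tau. Proof. by rewrite subr_gt0. Qed.

Let c_gt0 : 0 < c. Proof. exact: powR_gt0. Qed.

(** The scaling [c] is chosen for this identity, through which [t - s] disappears from all final
    estimates. *)
Let tau_c : tau * c `^ gamma = 1.
Proof.
rewrite /c -powRrM mulNr mulVf ?gt_eqF // powR_inv1 ?(ltW tau_gt0) //.
by rewrite mulfV // gt_eqF.
Qed.

Let y_scale x : tau * y (c *: x) = y x.
Proof.
by rewrite /y enormZ ?(ltW c_gt0) // powRM ?enorm_ge0 ?(ltW c_gt0) //
  mulrA tau_c mul1r.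
Qed.

Let nuV_ge0 : 0 <= nu^-1. Proof. by rewrite invr_ge0 ltW. Qed.

Let y_ge0 x : 0 <= y x. Proof. exact: powR_ge0. Qed.

Let symb_psi r : symb l (fun x => nu^-1 * y x) (psi r).
Proof.
apply: symb_rev => s' /subseq_mi_seq[beta -> bn].
have hb := leq_trans bn halpha; split; first exact: (symbol_derivable hpsi).
move=> x x0; have := symbol_bound hpsi r hb x0.
rewrite normC_le size_mi_seq /y enorm_powRD // powR_invn ?enorm_ge0 //.
by rewrite mulrA.
Qed.

(** The factor [tau^-1] is cancelled by the prefactor in [symb_psi_tau], and by the length of the
    interval of integration in [symb_I]. *)
Let symb_psi_scaled r :
  symb l (fun x => (nu^-1 * tau^-1) * y x) (fun x => psi r (c *: x)).
Proof.
apply: symb_le (symb_scale c_gt0 (symb_psi r)) => x x0.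
by rewrite -[y x]y_scale -mulrA mulKf // gt_eqF.
Qed.

Let symb_psi_tau r :
  symb l (fun x => nu^-1 * y x) (fun x => tau%:C * psi r (c *: x)).
Proof.
apply: symb_le (symbZ tau%:C (symb_psi_scaled r)) => x x0.
by rewrite cnormR gtr0_norm // -!mulrA mulrCA [tau * _]mulrA mulfV ?gt_eqF // mul1r.
Qed.

Let mu_st : fine (lebesgue_measure (`[s, t]%classic : set (measurableTypeR R))) = tau.
Proof. by rewrite lebesgue_measure_itv /= lte_fin st. Qed.

Let mu_st_fin :
  (lebesgue_measure (`[s, t]%classic : set (measurableTypeR R)) < +oo)%E.
Proof. by rewrite lebesgue_measure_itv /= lte_fin st -EFinB ltry. Qed.

Let measurable_psi (x : 'rV[R]_d) :
  cmeasurable (fun r : measurableTypeR R => psi r (c *: x)).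
Proof. exact: (cmeasurable_ysection (symbol_measurable hpsi)). Qed.

Let symb_I : symb l (fun x => 2 * nu^-1 * y x) I.
Proof.
have C0 : 0 <= nu^-1 * tau^-1 by rewrite mulr_ge0 // invr_ge0 ltW.
have := @symb_cintegral R d _ _ lebesgue_measure _ (measurable_itv `[s, t])
  mu_st_fin l _ gamma (fun r x => psi r (c *: x)) C0
  (fun x _ => measurable_psi x) symb_psi_scaled.
apply: symb_le => x x0; rewrite mu_st -/(y x) -!mulrA.
by rewrite (mulrCA tau) [tau * _]mulrA mulfV ?gt_eqF // mul1r.
Qed.

Let Re_I x : x != 0 -> complex.Re (I x) <= - (nu * y x).
Proof.
move=> x0; have cx0 : c *: x != 0 by rewrite scaler_eq0 negb_or x0 gt_eqF.
have [m1 _] := measurable_psi x.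
have ih : lebesgue_measure.-integrable `[s, t]
    (EFin \o (fun r : measurableTypeR R => complex.Re (psi r (c *: x)))).
  apply: (@bounded_integrable _ _ _ lebesgue_measure _ (measurable_itv `[s, t]) mu_st_fin _
    (nu^-1 * tau^-1 * y x)) => // r.
  apply: le_trans (Re_le_cnorm _) _; exact: (symb_bound (symb_psi_scaled r)).
have := @le_Rintegral _ _ _ lebesgue_measure `[s, t]
  (fun r : measurableTypeR R => complex.Re (psi r (c *: x)))
  (fun=> - (nu * y (c *: x))) (measurable_itv _) ih.
rewrite Rintegral_cst // mu_st => h.
rewrite -(y_scale x) mulrCA mulrC -mulNr; apply: h.
  exact: (@bounded_integrable _ _ _ lebesgue_measure _ (measurable_itv `[s, t]) mu_st_fin _
    `|- (nu * y (c *: x))|).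
by move=> r _; exact: (symbol_elliptic hpsi).
Qed.

Let cnorm_exp_I x : x != 0 -> cnorm (cexp (I x)) <= expR (- (nu * y x)).
Proof. by move=> x0; rewrite cnorm_cexp ler_expR; exact: Re_I. Qed.

(** By [1 + 2 z <= 2 (1 + z)], the 2 picked up in [symb_I] is traded for the constant [2 ^+ k]. *)
Let cexp_weight_le k x : x != 0 ->
  cexp_cst k * (1 + 2 * nu^-1 * y x) ^+ k * cnorm (cexp (I x)) <=
  cexp_cst k * 2 ^+ k * ((1 + nu^-1 * y x) ^+ k * expR (- (nu * y x))).
Proof.
move=> x0; have p0 : 0 <= nu^-1 * y x by rewrite mulr_ge0.
rewrite -[X in X <= _]mulrA -[X in _ <= X]mulrA ler_wpM2l ?cexp_cst_ge0 //.
rewrite [X in _ <= X]mulrA -exprMn ler_pM ?exprn_ge0 ?cnorm_ge0 ?cnorm_exp_I //.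
  by rewrite addr_ge0 // -mulrA mulr_ge0.
rewrite lerXn2r ?nnegrE ?mulr_ge0 ?addr_ge0 // -?mulrA ?mulr_ge0 //.
by rewrite mulrDr mulr1 lerD2r ler1n.
Qed.

(** Product of three symbol-class functions: the outer factors [2 ^+ n] come from the two products,
    [2 ^+ (n * a)] from the power. The orders [gamma a] and [b] add up, and [n] derivatives lower
    the sum by [n]. *)
Lemma q_base_derivable_bound (a : nat) (b Cb : R) :
  (forall l' : seq 'I_d, size l' = n ->
    symb l' (fun x => Cb * enorm x `^ b) (fun x => (enorm x `^ b)%:C)) ->
  mderivable_on (nonzero R d) alpha (q_base gamma psi a b s t) /\
  forall x, x != 0 -> cnorm (q_hat gamma psi alpha a b s t x) <=
    (2 ^+ n * (2 ^+ n * (2 ^+ (n * a) * nu^-1 ^+ a * Cb)) *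
      (cexp_cst n * 2 ^+ n)) *
    (enorm x `^ (gamma * a%:R + b - n%:R) * (1 + nu^-1 * y x) ^+ n *
      expR (- (nu * y x))).
Proof.
move=> hCb.
have := symbM (symbM (symbX a (symb_psi_tau t)) (hCb l size_l))
  (symb_le (fun x x0 => cexp_weight_le (size l) x0) (symb_cexp symb_I)).
move=> /symb_pderivs[h1 h2]; split=> // x x0.
apply: (le_trans (h2 x x0)).
rewrite !size_l size_mi_seq -/n le_eqVlt; apply/orP; left; apply/eqP.
rewrite !enorm_powRD // powR_invn ?enorm_ge0 // powRrM powR_mulrn ?powR_ge0 //.
rewrite -/(y x) exprMn; ring.
Qed.

(** Only the exponential is left. Its first derivative yields the factor [D_i I] of order
    [gamma - 1], so the exponent is [gamma - n] instead of [-n]. *)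
Lemma q_base_derivable_bound0 : (0 < n)%N ->
  mderivable_on (nonzero R d) alpha (q_base gamma psi 0 0 s t) /\
  forall x, x != 0 -> cnorm (q_hat gamma psi alpha 0 0 s t x) <=
    (2 ^+ n.-1 * (2 * nu^-1) * (cexp_cst n.-1 * 2 ^+ n.-1)) *
    (enorm x `^ (gamma - n%:R) * (1 + nu^-1 * y x) ^+ n.-1 *
      expR (- (nu * y x))).
Proof.
move=> n_gt0.
have E : q_base gamma psi 0 0 s t = fun x => cexp (I x).
  by apply/funext => x; rewrite /q_base expr0 powRr0 !mul1r.
rewrite /mderivable_on /q_hat /mderiv E.
have := symb_I; rewrite /l.
have sn : size (mi_seq alpha) = n by rewrite size_mi_seq.
(* The last entry is the derivative taken first; it is split off and the remaining [n - 1] go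
   through [symb_cexp_pderiv]. *)
case/lastP: (mi_seq alpha) sn => [n0|s' i]; first by rewrite -n0 in n_gt0.
rewrite size_rcons rev_rcons => sn [h1 h2 h3].
have sn' : size (rev s') = n.-1 by rewrite size_rev -sn.
have := symb_cexp_pderiv h2 h3 (symb_cexp h1).
move=> /symb_pderivs[k1 k2]; split.
  apply/pderivables_on_rcons; split => // x x0.
  exact: (is_pderivW (is_pderiv_cexp (pderivP (h2 x x0)))).
move=> x x0; rewrite pderivs_rcons; apply: (le_trans (k2 x x0)).
have := cexp_weight_le n.-1 x0; rewrite sn'.
set W := _ * cnorm _ => hW.
have e0 : 0 < enorm x := enorm_gt0 x0.
have -> : enorm x `^ (gamma - n%:R) = y x / (enorm x * enorm x ^+ n.-1).
  by rewrite enorm_powRD // powR_invn ?enorm_ge0 // -exprS prednK.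
have ss : size s' = n.-1 by rewrite -sn.
rewrite ss.
have -> : 2 ^+ n.-1 * (2 * nu^-1 * y x / enorm x * W) / enorm x ^+ n.-1 =
  2 ^+ n.-1 * (2 * nu^-1) * (y x / (enorm x * enorm x ^+ n.-1)) * W.
  by rewrite invfM; ring.
have K0 : 0 <= 2 ^+ n.-1 * (2 * nu^-1) * (y x / (enorm x * enorm x ^+ n.-1)).
  by rewrite !mulr_ge0 ?exprn_ge0 ?invr_ge0 ?mulr_ge0 ?exprn_ge0 // ltW.
apply: (le_trans (ler_wpM2l K0 hW)).
by rewrite le_eqVlt; apply/orP; left; apply/eqP; ring.
Qed.

End scaled_symbol.

(** * The uniform bound, first for each order of differentiation and then for all *)

Lemma mi_abs_gt0 (d : nat) (alpha : multi_index d) :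
  alpha <> [ffun=> 0%N] -> (0 < mi_abs alpha)%N.
Proof.
move=> h; rewrite lt0n; apply/negP => /eqP; rewrite /mi_abs => e; apply: h.
apply/ffunP => i; rewrite ffunE; apply/eqP; rewrite -leqn0 -e.
by rewrite (bigD1 i) //= leq_addr.
Qed.

Lemma q_uniform_bound (R : realType) (d : nat) (gamma nu : R) (a : nat) (b : R)
    (n : nat) : (0 < d)%N -> 0 < gamma -> 0 < nu -> (n <= (d %/ 2).+1)%N ->
  exists2 N : R, 0 <= N &
    forall psi : R -> 'rV[R]_d -> R[i], symbol_assumption gamma nu psi ->
    forall alpha : multi_index d, mi_abs alpha = n ->
    ((a = 0%N /\ b = 0 /\ alpha <> [ffun=> 0%N]) \/
     gamma * a%:R + b - n%:R > - d%:R) ->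
    forall s t : R, s < t ->
      [/\ mderivable_on (nonzero R d) alpha (q_base gamma psi a b s t),
          cintegrable (lebesgue_rV R d) setT (q_hat gamma psi alpha a b s t) &
          forall x, cnorm (q gamma psi alpha a b s t x) <= N].
Proof.
move=> d0 g0 nu0 nd.
have nuV : 0 <= nu^-1 by rewrite invr_ge0 ltW.
(* For [d >= 1], [floor(d/2) + 1 <= d]; hence [gamma - n > -d], which gives integrability in the
   case [a = b = 0]. *)
have n_le_d : (n <= d)%N.
  apply: leq_trans nd _; case: (d) d0 => [//|[//|k]] _.
  by rewrite divn2 /= !ltnS -divn2 leq_div.
pose C1 : R := (2 ^+ n.-1 * (2 * nu^-1) * (cexp_cst n.-1 * 2 ^+ n.-1)).
have C10 : 0 <= C1 by rewrite !mulr_ge0 ?exprn_ge0 ?cexp_cst_ge0.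
have p1 : - d%:R < gamma - n%:R.
  have : n%:R <= d%:R :> R by rewrite ler_nat.
  by lra.
have [N1 N10 h1] := powR_expR_inv_fourier n.-1 d0 g0 nu0 p1 C10.
have [Cb Cb0 hCb] := @symb_enorm_powR R d n b.
pose C2 : R := (2 ^+ n * (2 ^+ n * (2 ^+ (n * a) * nu^-1 ^+ a * Cb)) *
      (cexp_cst n * 2 ^+ n)).
have C20 : 0 <= C2 by rewrite !mulr_ge0 ?exprn_ge0 ?cexp_cst_ge0.
have mq psi : symbol_assumption gamma nu psi -> forall alpha a b s t,
    mderivable_on (nonzero R d) alpha (q_base gamma psi a b s t) ->
    cmeasurable (q_hat gamma psi alpha a b s t).
  move=> hpsi alpha a' b' s t; apply: cmeasurable_pderivs.
  exact: (cmeasurable_q_base _ (symbol_measurable hpsi)).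
(* The inequality involves only [n], so the constant may depend on whether it holds. If it holds the
   general estimate applies; otherwise the first alternative must be the true one. *)
have [p2|p2] := boolP (- d%:R < gamma * a%:R + b - n%:R); last first.
  exists N1 => // psi hpsi alpha an [[a0 [b0 al0]]|p2' s t st]; last first.
    by [].
  move=> s t st; subst a b.
  have hal : (mi_abs alpha <= (d %/ 2).+1)%N by rewrite an.
  have [D B] := q_base_derivable_bound0 g0 nu0 hpsi st hal (mi_abs_gt0 al0).
  rewrite an in B.
  by have [I F] := h1 _ (mq psi hpsi _ _ _ _ _ D) B; split.
have [N2 N20 h2] := powR_expR_inv_fourier n d0 g0 nu0 p2 C20.
exists N2 => // psi hpsi alpha an _ s t st.
have hal : (mi_abs alpha <= (d %/ 2).+1)%N by rewrite an.
have [|D B] := @q_base_derivable_bound R d _ _ _ g0 nu0 hpsi s t st alpha hal a b Cb.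
  by rewrite an.
rewrite an in B.
by have [I F] := h2 _ (mq psi hpsi _ _ _ _ _ D) B; split.
Qed.

Unset Implicit Arguments.

Theorem corollary3p3 (R : realType) (d : nat) (hd : (0 < d)%N)
    (gamma nu : R) (hgamma : 0 < gamma) (hnu : 0 < nu) (a : nat) (b : R) :
  exists N : R,
    forall psi : R -> 'rV[R]_d -> R[i], symbol_assumption gamma nu psi ->
    forall alpha : multi_index d, (mi_abs alpha <= (d %/ 2).+1)%N ->
    ((a = 0%N /\ b = 0 /\ alpha <> [ffun=> 0%N]) \/
     gamma * a%:R + b - (mi_abs alpha)%:R > - d%:R) ->
    forall s t : R, s < t ->
      [/\ mderivable_on (nonzero R d) alpha (q_base gamma psi a b s t),
          cintegrable (lebesgue_rV R d) setT (q_hat gamma psi alpha a b s t) &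
          forall x : 'rV[R]_d, `|q gamma psi alpha a b s t x| <= N%:C].
Proof.
(* One nonnegative constant is chosen for each order from 0 to [floor(d/2) + 1]; their sum dominates
   each of them and no longer depends on [alpha]. *)
have bound (n : 'I_(d %/ 2).+2) :=
  cid2 (q_uniform_bound a b hd hgamma hnu (ltn_ord n : (n <= _)%N)).
pose N n := s2val (bound n).
exists (\sum_n N n) => psi hpsi alpha hal hab s t st.
pose k : 'I_(d %/ 2).+2 := Ordinal (hal : (mi_abs alpha < (d %/ 2).+2)%N).
have [D I B] := s2valP' (bound k) psi hpsi alpha erefl hab s t st.
split => // x; rewrite normC_le; apply: le_trans (B x) _.
rewrite (bigD1 k) //= lerDl; apply: sumr_ge0 => j _.
exact: (s2valP (bound j)).
Qed.
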